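(* The metric exponential $\mathrm{Exp}_{\mathrm M}(X)$, stratified over $\omega_\ast$ by $S\mapsto|S|$, is conically stratified whenever $X$ is a separated (Hausdorff) topological space locally homeomorphic to a rotund vector space.
   Context: Rotund vector space: a (real) topological vector space whose topology can be induced by a norm such that $\|x\|=\|y\|=\|\tfrac{x+y}{2}\|$ holds only when $x=y$. $X$ is locally homeomorphic to a rotund vector space if every point of $X$ has an open neighbourhood homeomorphic to a rotund vector space (which may depend on the point). Metric exponential $\mathrm{Exp}_{\mathrm M}(X)$: the set $\mathrm{Exp}(X)$ of finite subsets of $X$ (including the empty one) with the coarsest topology including all sets $[U_i]_{i\in I}:=\{S\in\mathrm{Exp}(X)\mid S\cap U_i\ne\emptyset\ \text{for all } i\in I\}$, for every finite set $I$ of open subsets $U_i\subset X$. $\omega_\ast$ is the poset $\{0\}\sqcup\{1<2<\cdots\}$ ($0$ is incomparable to the other elements). A stratified space is a continuous map $Y\to P$ to a poset $P$ endowed with the topology whose opens are the upward-closed subsets; $Y_p$ is the fiber over $p$. Open cone: $\mathrm C(L):=\{0\}\sqcup(\mathbf R_+^\ast\times L)$, where $U$ is open iff $U\cap(\mathbf R_+^\ast\times L)$ is open and, if $0\in U$, then $(0,\varepsilon)\times L\subset U$ for some $\varepsilon>0$. If $L$ is stratified over $P$, $\mathrm C(L)$ is stratified over $P^\triangleleft$, which is $P$ with a new least element added (the image of the tip $0$). Conically stratified: a stratified space $Y\to P$ is conically stratified if for each $p\in P$ and each $y\in Y_p$ there exist an open neighbourhood $U_p\subset Y_p$ of $y$,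 a stratified space $L$ over $P_{>p}=\{q\in P\mid q>p\}$, and an open embedding $U_p\times\mathrm C(L)\to Y$ which extends the inclusion $U_p=U_p\times\{0\}\subset Y_p$ and is a map of stratified spaces over the poset map $P_{>p}^\triangleleft\cong P_{\ge p}\subset P$.
   Formalization: The basic open sets [U_i] of Exp_M(X) are taken to be the finite S contained in the union of the U_i and meeting every U_i; without the containment, {∅} is not open for nonempty X, so S ↦ |S| is not continuous to ω_* and the claim fails. *)

(* Defs.v *)
From HB Require Import structures.
From mathcomp Require Import all_boot all_order all_algebra finmap.
From mathcomp Require Import all_classical reals topology normedtype.

Set Implicit Arguments.
Unset Strict Implicit.
Unset Printing Implicit Defensive.

Import Order.TTheory GRing.Theory Num.Theory.
Import numFieldNormedType.Exports.

Local Open Scope classical_set_scope.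
Local Open Scope ring_scope.

(* A subset [A : set T] of a topological space is regarded as a space through
   the coercion [set_type], which carries the induced topology. *)

Definition open_embedding (S T : topologicalType) (f : S -> T) : Prop :=
  [/\ continuous f, injective f & forall A : set S, open A -> open (f @` A)].

Definition homeomorphic (S T : topologicalType) : Prop :=
  exists (f : S -> T) (g : T -> S),
    [/\ continuous f, continuous g, cancel f g & cancel g f].

Record is_norm (R : realType) (V : lmodType R) (N : V -> R) : Prop := IsNorm {
  is_norm_triangle : forall x y, N (x + y) <= N x + N y ;
  is_norm_homogeneous : forall (a : R) x, N (a *: x) = `|a| * N x ;
  is_norm_definite : forall x, N x = 0 -> x = 0
}.

Definition induces_topology (R : realType) (V : topologicalLmodType R)
    (N : V -> R) : Prop :=
  forall (x : V) (A : set V),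
    nbhs x A <-> exists2 e : R, 0 < e & [set y | N (y - x) < e] `<=` A.

Definition rotund (R : realType) (V : topologicalLmodType R) : Prop :=
  exists N : V -> R,
    [/\ is_norm N, induces_topology N &
        forall x y, N x = N y -> N y = N (2^-1 *: (x + y)) -> x = y].

Definition locally_rotund (R : realType) (X : topologicalType) : Prop :=
  forall x : X, exists (U : set X) (V : topologicalLmodType R),
    [/\ open_nbhs x U, rotund V & homeomorphic U V].

(* The index [F] ranges over the finite sets of open subsets of [X].  The basic
   open set attached to [F] consists of the finite [S] contained in the union
   of [F] and meeting every member of [F].  Without the containment clause
   every open set containing the empty set would be the whole space, and the
   cardinality would not be continuous for the topology of [omega_star],
   in which {0} is open. *)
Definition metric_exp (X : choiceType) : Type := {fset X}.

HB.instance Definition _ (X : choiceType) := Choice.on (metric_exp X).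

Definition exp_open (X : choiceType) (F : set (set X)) : set (metric_exp X) :=
  [set S : {fset X} | [set` S] `<=` \bigcup_(U in F) U /\
                      forall U, F U -> [set` S] `&` U !=set0].

HB.instance Definition _ (X : topologicalType) :=
  isSubBaseTopological.Build (metric_exp X)
    [set F : set (set X) | finite_set F /\ F `<=` open] (@exp_open X).

Definition alexandrov (P : Type) : Type := P.

Section Alexandrov.
Context {d : Order.disp_t} {P : porderType d}.

Definition up_closed (A : set P) : Prop :=
  forall x y, A x -> (x <= y)%O -> A y.

Let up_closedT : up_closed setT. Proof. by []. Qed.

Let up_closedI : setI_closed up_closed.
Proof.
by move=> A B uA uB x y [Ax Bx] xy; split; [exact: uA xy|exact: uB xy].
Qed.

Let up_closed_bigU (I : Type) (f : I -> set P) :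
  (forall i, up_closed (f i)) -> up_closed (\bigcup_i f i).
Proof. by move=> uf x y [i _ fix_] xy; exists i => //; exact: uf xy. Qed.

HB.instance Definition _ := Choice.on (alexandrov P).
HB.instance Definition _ := @isOpenTopological.Build (alexandrov P)
  up_closed up_closedT up_closedI up_closed_bigU.

End Alexandrov.

Definition stratified d (P : porderType d) (Y : topologicalType) (s : Y -> P) :
  Prop := continuous (s : Y -> alexandrov P).

Definition fiber (P Y : Type) (s : Y -> P) (p : P) : set Y := s @^-1` [set p].

Definition above d (P : porderType d) (p : P) : Type := {q : P | (p < q)%O}.

Section AboveOrder.
Context {d : Order.disp_t} {P : porderType d} (p : P).
HB.instance Definition _ := SubChoice.on (above p).
HB.instance Definition _ := [SubChoice_isSubPOrder of above p by <: with d].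
End AboveOrder.

(* [None] is the added least element. *)
Definition left_cone (P : Type) : Type := option P.

Section LeftCone.
Context {d : Order.disp_t} {P : porderType d}.

Definition left_cone_le (x y : left_cone P) : bool :=
  match x, y with
  | None, _ => true
  | Some _, None => false
  | Some a, Some b => (a <= b)%O
  end.

Let left_cone_le_refl : reflexive left_cone_le. Proof. by case=> /=. Qed.

Let left_cone_le_anti : antisymmetric left_cone_le.
Proof. by move=> [a|] [b|] //= /le_anti ->. Qed.

Let left_cone_le_trans : transitive left_cone_le.
Proof. by move=> [b|] [a|] [c|] //=; exact: le_trans. Qed.

HB.instance Definition _ := Choice.on (left_cone P).
HB.instance Definition _ := Order.Le_isPOrder.Build d (left_cone P)
  left_cone_le_refl left_cone_le_anti left_cone_le_trans.

End LeftCone.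

Definition above_cone_val d (P : porderType d) (p : P)
  (x : left_cone (above p)) : P := if x is Some q then \val q else p.

Lemma above_cone_val_mono d (P : porderType d) (p : P) :
  {mono @above_cone_val d P p : x y / (x <= y)%O}.
Proof.
move=> [[a pa]|] [[b pb]|] //=; first by rewrite /= lt_geF.
- by rewrite ltW.
- by rewrite lexx.
Qed.

Lemma above_cone_val_range d (P : porderType d) (p : P) :
  range (@above_cone_val d P p) = [set q : P | (p <= q)%O].
Proof.
apply/seteqP; split=> [_ [[[q pq]|] _ <-] /=|q /=]; first exact: ltW.
- exact: lexx.
- rewrite le_eqVlt => /predU1P[<-|pq]; first by exists None.
  by exists (Some (Sub q pq)).
Qed.

(* [None] is the tip. *)
Definition open_cone (R : realType) (L : Type) : Type :=
  option ((`]0, +oo[%classic : set R) * L).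

Definition cone_tip (R : realType) (L : Type) : open_cone R L := None.

Section OpenCone.
Context {R : realType} {L : topologicalType}.

Definition cone_op (U : set (open_cone R L)) : Prop :=
  open (Some @^-1` U) /\
  (U (cone_tip R L) -> exists2 e : R, 0 < e &
     forall (t : (`]0, +oo[%classic : set R)) (l : L),
       \val t < e -> U (Some (t, l))).

Let cone_opT : cone_op setT.
Proof. by split; [rewrite preimage_setT; exact: openT|exists 1]. Qed.

Let cone_opI : setI_closed cone_op.
Proof.
move=> A B [oA tA] [oB tB]; split; first by rewrite preimage_setI; exact: openI.
move=> [/tA[a a0 Aa] /tB[b b0 Bb]]; exists (Num.min a b).
  by rewrite lt_min a0.
by move=> t l; rewrite lt_min => /andP[ta tb]; split; [exact: Aa|exact: Bb].
Qed.

Let cone_op_bigU (I : Type) (f : I -> set (open_cone R L)) :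
  (forall i, cone_op (f i)) -> cone_op (\bigcup_i f i).
Proof.
move=> of_; split.
  by rewrite preimage_bigcup; apply: bigcup_open => i _; case: (of_ i).
move=> [i _ fi]; have [_ /(_ fi)[e e0 fe]] := of_ i.
by exists e => // t l te; exists i => //; exact: fe.
Qed.

HB.instance Definition _ := Choice.on (open_cone R L).
HB.instance Definition _ := @isOpenTopological.Build (open_cone R L)
  cone_op cone_opT cone_opI cone_op_bigU.

End OpenCone.

Definition cone_strat (R : realType) (L P : Type) (s : L -> P)
  (c : open_cone R L) : left_cone P := if c is Some (_, l) then Some (s l) else None.

Lemma cone_strat_stratified (R : realType) d (P : porderType d)
    (L : topologicalType) (s : L -> P) :
  stratified s -> stratified (@cone_strat R L P s).
Proof.
move=> /continuousP cs; apply/continuousP => A uA; split.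
- pose B : set (alexandrov P) := [set q | A (Some q)].
  have oB : open B by move=> x y Ax xy; exact: uA Ax _.
  have -> : Some @^-1` (@cone_strat R L P s @^-1` A) =
      snd @^-1` ((s : L -> alexandrov P) @^-1` B).
    by apply/seteqP; split=> -[].
  apply: open_comp; first by move=> x _; exact: cvg_snd.
  exact: cs.
- move=> A0; exists 1 => // t l _; exact: uA A0 _.
Qed.

Definition conically_stratified (R : realType) d (P : porderType d)
    (Y : topologicalType) (s : Y -> P) : Prop :=
  stratified s /\
  forall (p : P) (y : fiber s p),
  exists (U : set (fiber s p)) (L : topologicalType) (l : L -> above p)
         (h : U * open_cone R L -> Y),
    [/\ open_nbhs y U, stratified l, open_embedding h,
        forall u : U, h (u, cone_tip R L) = \val (\val u) &
        forall (u : U) (c : open_cone R L),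
          s (h (u, c)) = above_cone_val (cone_strat l c)].

(* The poset {0} + {1 < 2 < ...}, carried by the natural numbers. *)
Definition omega_star : Type := nat.

Fact omega_star_display : Order.disp_t. Proof. exact: Order.Disp tt tt. Qed.

Section OmegaStar.

Definition omega_star_le (m n : omega_star) : bool :=
  (m == n :> nat) || ((0 < m)%N && (m <= n)%N).

Let omega_star_le_refl : reflexive omega_star_le.
Proof. by move=> n; rewrite /omega_star_le eqxx. Qed.

Let omega_star_le_anti : antisymmetric omega_star_le.
Proof.
move=> m n /andP[/predU1P[//|/andP[_ mn]] /predU1P[->//|/andP[_ nm]]].
by apply/eqP; rewrite eqn_leq mn.
Qed.

Let omega_star_le_trans : transitive omega_star_le.
Proof.
move=> n m k /predU1P[->//|/andP[m0 mn]] /predU1P[<-|/andP[_ nk]].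
  by rewrite /omega_star_le m0 mn orbT.
by rewrite /omega_star_le m0 (leq_trans mn nk) orbT.
Qed.

HB.instance Definition _ := Choice.on omega_star.
HB.instance Definition _ :=
  Order.Le_isPOrder.Build omega_star_display omega_star
    omega_star_le_refl omega_star_le_anti omega_star_le_trans.

End OmegaStar.

Definition exp_card (X : choiceType) (S : metric_exp X) : omega_star :=
  #|` (S : {fset X})|%fset.

(* Main.v *)
(* A nonempty finite subset A of a rotund space has a canonical center: the
   unique point c of the convex hull of A minimizing max_(a in A) |a - c|.
   Compactness of the hull gives existence, rotundity gives uniqueness (the
   midpoint of two minimizers would be strictly better), and together they give
   continuity in the Hausdorff metric; minimizing over the hull rather than over
   the whole space is what makes this work in infinite dimension.  Center and
   radius are equivariant under translations and positive dilations.

   Given S in Exp(X), choose disjoint charts V_s -> X around the points s of S.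
   The finite sets T contained in the union of the charts and meeting each of
   them form a neighbourhood of S, and such a T is determined by the centers of
   its pieces, the largest radius t of the pieces, and, when t > 0, the set
   obtained by translating every center to 0 and dividing by t.  The link
   consists of the sets with all centers 0 and largest radius 1; the tip of the
   cone (t = 0) corresponds to the T with one point in each chart, which are
   those with |T| = |S|. *)
From HB Require Import structures.
Require Import Defs.
From mathcomp Require Import all_boot all_order all_algebra finmap.
From mathcomp Require Import ring lra.
From mathcomp Require Import all_classical reals topology normedtype derive.

Set Implicit Arguments.
Unset Strict Implicit.
Unset Printing Implicit Defensive.

Import Order.TTheory GRing.Theory Num.Theory.
Import numFieldNormedType.Exports.

Local Open Scope classical_set_scope.
Local Open Scope ring_scope.

(** * Norms and convex hulls *)

Section Norm.
Context {R : realType} {V : topologicalLmodType R} {N : V -> R}.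
Context (normN : is_norm N).

Lemma is_norm0 : N 0 = 0.
Proof. by rewrite -(scale0r 0) is_norm_homogeneous// normr0 mul0r. Qed.

Lemma is_normN x : N (- x) = N x.
Proof. by rewrite -scaleN1r is_norm_homogeneous// normrN1 mul1r. Qed.

Lemma is_norm_ge0 x : 0 <= N x.
Proof.
have := is_norm_triangle normN x (- x).
by rewrite subrr is_norm0 is_normN; lra.
Qed.

Lemma is_norm_distC x y : N (x - y) = N (y - x).
Proof. by rewrite -is_normN opprB. Qed.

Lemma is_norm_dist_triangle y x z : N (x - z) <= N (x - y) + N (y - z).
Proof. by have := is_norm_triangle normN (x - y) (y - z); rewrite addrA subrK. Qed.

Lemma is_norm_posZ (a : R) x : 0 <= a -> N (a *: x) = a * N x.
Proof. by move=> a0; rewrite is_norm_homogeneous// ger0_norm. Qed.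

Lemma is_norm_eq x y : N (x - y) <= 0 -> x = y.
Proof.
move=> xy; apply/eqP; rewrite -subr_eq0; apply/eqP/(is_norm_definite normN).
by apply/eqP; rewrite eq_le xy is_norm_ge0.
Qed.

End Norm.

Section Convex.
Context {R : realType} {V : topologicalLmodType R}.

Definition convex (C : set V) : Prop := forall (x y : V) (s : R),
  0 <= s <= 1 -> C x -> C y -> C (s *: x + (1 - s) *: y).

(** The intersection of all convex sets containing [A]. This form acts as an induction principle: a
    property that is convex and holds on [A] holds on the hull. *)
Definition hull (A : set V) : set V :=
  [set c | forall C, convex C -> A `<=` C -> C c].

Lemma convex_hull A : convex (hull A).
Proof. by move=> x y s s01 Ax Ay C cC AC; apply: (cC) (Ax _ _ _) (Ay _ _ _). Qed.

Lemma sub_hull A : A `<=` hull A.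
Proof. by move=> x Ax C _; apply. Qed.

Lemma convex_join (K : set V) x : convex K -> K !=set0 ->
  convex [set z | exists y (a : R), [/\ K y, 0 <= a <= 1 &
                                        z = a *: x + (1 - a) *: y]].
Proof.
move=> cK _ _ _ s s01 [y [a [Ky a01 ->]]] [z [b [Kz b01 ->]]].
set m := s * (1 - a) + (1 - s) * (1 - b).
have sum_m : 1 - (s * a + (1 - s) * b) = m by rewrite /m; ring.
have -> : s *: (a *: x + (1 - a) *: y) + (1 - s) *: (b *: x + (1 - b) *: z) =
    (s * a + (1 - s) * b) *: x +
    ((s * (1 - a)) *: y + ((1 - s) * (1 - b)) *: z).
  by rewrite !scalerDr !scalerA scalerDl addrACA.
have m0 : 0 <= m by rewrite /m; nra.
(* [m] is the total weight put on points of [K]. If it vanishes, both weights vanish and the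
   combination is [x]; otherwise dividing by [m] gives a convex combination inside [K]. *)
have [m_eq0|m_neq0] := eqVneq m 0.
  have -> : s * (1 - a) = 0 by move: m_eq0; rewrite /m; nra.
  have -> : (1 - s) * (1 - b) = 0 by move: m_eq0; rewrite /m; nra.
  exists y, 1; split => //; first by rewrite ler01 lexx.
  by rewrite subrr !scale0r !addr0; congr (_ *: _); move: sum_m m_eq0; lra.
exists ((s * (1 - a) / m) *: y + (1 - s * (1 - a) / m) *: z).
exists (s * a + (1 - s) * b); split.
- apply: cK => //; rewrite divr_ge0//=; last by nra.
  by rewrite ler_pdivrMr ?lt0r ?m_neq0// mul1r /m; nra.
- by apply/andP; split; [nra|rewrite -subr_ge0 sum_m].
rewrite sum_m scalerDr !scalerA; congr (_ + (_ *: _ + _ *: _)).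
- by rewrite [RHS]mulrC divfK.
- by rewrite [RHS]mulrBr mulr1 [m * (_ / _)]mulrC divfK// /m; ring.
Qed.

Lemma tlmod_cvgD (T : Type) (F : set_system T) (FF : Filter F) (f g : T -> V)
  (a b : V) : f @ F --> a -> g @ F --> b -> (fun x => f x + g x) @ F --> a + b.
Proof.
by move=> fa gb; apply: (cvg_comp2 fa gb); exact: (@add_continuous V (a, b)).
Qed.

Lemma tlmod_cvgZ (T : Type) (F : set_system T) (FF : Filter F) (k : T -> R^o)
    (f : T -> V) (l : R^o) (a : V) :
  k @ F --> l -> f @ F --> a -> (fun x => k x *: f x) @ F --> l *: a.
Proof.
by move=> kl fa; apply: (cvg_comp2 kl fa); exact: (@scale_continuous _ V (l, a)).
Qed.

Lemma compact_join (K : set V) x : compact K ->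
  compact [set z | exists y (a : R), [/\ K y, 0 <= a <= 1 &
                                        z = a *: x + (1 - a) *: y]].
Proof.
move=> cK.
pose f (p : R^o * V) := p.1 *: x + (1 - p.1) *: p.2.
have -> : [set z | exists y (a : R), [/\ K y, 0 <= a <= 1 &
              z = a *: x + (1 - a) *: y]] = f @` (`[0, 1]%classic `*` K).
  apply/seteqP; split=> [_ [y [a [Ky a01 ->]]]|_ [[a y] [/= a01 Ky] <-]].
    by exists (a, y).
  by exists y, a; split => //; rewrite in_itv in a01.
apply: continuous_compact.
  apply: continuous_subspaceT => p.
  have cfst : (fun q : R^o * V => q.1) @ p --> (p.1 : R^o) by exact: cvg_fst.
  apply: tlmod_cvgD; apply: tlmod_cvgZ; [exact: cfst|exact: cvg_cst| |exact: cvg_snd].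
  by apply: cvgB; [exact: cvg_cst|exact: cfst].
apply: (@compact_setX R^o V) => //; exact: segment_compact.
Qed.

(** By induction on a list of the points: joining a new point to a compact convex [K] gives a
    compact convex set, which lies in the hull as soon as [K] does. *)
Lemma hull_compact (A : set V) : finite_set A -> compact (hull A).
Proof.
move=> /finite_seqP[s ->].
suff [K [cK convK sK Kh]] : exists K : set V, [/\ compact K, convex K,
    [set` s] `<=` K & K `<=` hull [set` s]].
  by have <- : K = hull [set` s]
    by apply/seteqP; split=> // z; apply.
elim: s => [|x s [K [cK convK sK Kh]]].
  exists set0; split => //; exact: compact0.
(* The join of [x] with an empty set is empty, so the first point is treated apart. *)
have [K0|K0] := pselect (K !=set0); last first.
  have s0 y : y \notin s by apply/negP => /sK Ky; apply: K0; exists y.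
  exists [set x]; split.
  - exact: compact_set1.
  - by move=> _ _ a _ -> ->; rewrite -scalerDl addrC subrK scale1r.
  - by move=> y /=; rewrite inE (negbTE (s0 y)) orbF => /eqP.
  - by move=> _ ->; apply: sub_hull; rewrite /= mem_head.
exists [set z | exists y (a : R), [/\ K y, 0 <= a <= 1 &
                                        z = a *: x + (1 - a) *: y]]; split.
- exact: compact_join.
- exact: convex_join.
- move=> y /=; rewrite inE => /predU1P[->|ys].
    have [z Kz] := K0; exists z, 1; split => //; first by rewrite ler01 lexx.
    by rewrite subrr scale0r addr0 scale1r.
  exists y, 0; split; [exact: sK|by rewrite ler01 lexx|].
  by rewrite subr0 scale0r add0r scale1r.
- move=> _ [y [a [Ky a01 ->]]]; apply: convex_hull => //.
    by apply: sub_hull; rewrite /= mem_head.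
  move=> C cC sC; apply: Kh => // z zs; apply: sC.
  by rewrite /= inE; apply/orP; right.
Qed.

End Convex.

(** * Chebyshev centers *)

Section Chebyshev.
Context {R : realType} {V : topologicalLmodType R} (N : V -> R).

(** For finite [A], the radius of the smallest closed ball about [c] containing [A]. On an infinite
    [A] it takes the junk value 0, since [fset_set] is then empty. *)
Definition rad_at (A : set V) (c : V) : R :=
  \big[Num.max/0]_(t <- fset_set A) N (t - c).

Definition is_cheb (A : set V) (c : V) : Prop :=
  hull A c /\ forall c', hull A c' -> rad_at A c <= rad_at A c'.

(** The default 0 is returned only when no center exists; [chebP] excludes this for finite nonempty
    [A]. *)
Definition cheb (A : set V) : V := xget 0 (is_cheb A).

Definition radius (A : set V) : R := rad_at A (cheb A).

Definition affine_image (v : V) (t : R) (A : set V) : set V :=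
  [set v + t *: y | y in A].

Definition hausdorff_lt (e : R) (A B : set V) : Prop :=
  (forall a, A a -> exists2 b, B b & N (a - b) < e) /\
  (forall b, B b -> exists2 a, A a & N (a - b) < e).

Lemma hausdorff_lt_le e e' A B : e <= e' ->
  hausdorff_lt e A B -> hausdorff_lt e' A B.
Proof.
move=> ee' [h1 h2]; split=> v.
  by move=> /h1[w Tw vw]; exists w => //; exact: lt_le_trans vw ee'.
by move=> /h2[w Tw vw]; exists w => //; exact: lt_le_trans vw ee'.
Qed.

Lemma rad_at_ge0 A c : 0 <= rad_at A c.
Proof. by rewrite /rad_at bigmax_idl le_max lexx. Qed.

Lemma le_rad_at A c t : finite_set A -> A t -> N (t - c) <= rad_at A c.
Proof.
move=> fA At; rewrite /rad_at.
apply: (@le_bigmax_seq _ _ _ _ _ t predT (fun t => N (t - c))) => //.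
by rewrite in_fset_set// inE.
Qed.

Lemma rad_at_le A c r : finite_set A -> 0 <= r ->
  (forall t, A t -> N (t - c) <= r) -> rad_at A c <= r.
Proof.
move=> fA r0 Ar; rewrite /rad_at big_seq; apply: bigmax_le => // t.
by rewrite in_fset_set// inE; exact: Ar.
Qed.

Lemma rad_at_lt A c r : finite_set A -> 0 < r ->
  (forall t, A t -> N (t - c) < r) -> rad_at A c < r.
Proof.
move=> fA r0 Ar; rewrite /rad_at big_seq; apply: bigmax_lt => // t.
by rewrite in_fset_set// inE; exact: Ar.
Qed.

(** The inverse of a translation and dilation has the same form, so one-sided estimates for
    [affine_image] become equalities once applied to the inverse too. *)
Lemma affine_imageK v t A : t != 0 ->
  affine_image (- (t^-1 *: v)) t^-1 (affine_image v t A) = A.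
Proof.
move=> t0; have E y : - (t^-1 *: v) + t^-1 *: (v + t *: y) = y.
  by rewrite scalerDr scalerA mulVf// scale1r addKr.
apply/seteqP; split=> [_ [_ [y Ay <-] <-]|y Ay]; first by rewrite E.
by exists (v + t *: y); [exists y|exact: E].
Qed.

Lemma finite_affine_image v t A : finite_set A -> finite_set (affine_image v t A).
Proof. exact: finite_image. Qed.

Lemma hull_affine v t A c : hull A c -> hull (affine_image v t A) (v + t *: c).
Proof.
move=> /(_ [set c | hull (affine_image v t A) (v + t *: c)]); apply.
  move=> x y s s01 /= hx hy.
  suff -> : v + t *: (s *: x + (1 - s) *: y) =
    s *: (v + t *: x) + (1 - s) *: (v + t *: y) by exact: convex_hull.
  rewrite !scalerDr addrACA -scalerDl [s + _]addrC subrK scale1r.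
  by congr (_ + (_ + _)); rewrite !scalerA mulrC.
by move=> y Ay /=; apply: sub_hull; exists y.
Qed.

Context (normN : is_norm N) (indN : induces_topology N).

Lemma nbhs_normP (x : V) (e : R) : 0 < e -> \forall y \near x, N (y - x) < e.
Proof. by move=> e0; apply/indN; exists e. Qed.

Lemma rad_at1 x c : rad_at [set x] c = N (x - c).
Proof.
apply/eqP; rewrite eq_le le_rad_at// andbT.
by apply: rad_at_le => [//||_ ->//]; exact: is_norm_ge0.
Qed.

Lemma rad_at_lipschitz A c c' : finite_set A ->
  rad_at A c' <= rad_at A c + N (c' - c).
Proof.
move=> fA; apply: rad_at_le => //.
  by rewrite addr_ge0 ?rad_at_ge0 ?is_norm_ge0.
move=> t At; have := le_rad_at c fA At.
by have := is_norm_dist_triangle normN c t c'; rewrite (is_norm_distC normN c c'); lra.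
Qed.

Lemma rad_at_continuous A : finite_set A -> continuous (rad_at A : V -> R).
Proof.
move=> fA c; apply/cvgrPdist_lt => e e0; near=> x.
have xc : N (x - c) < e by near: x; exact: nbhs_normP.
have := rad_at_lipschitz c x fA; have := rad_at_lipschitz x c fA.
by rewrite (is_norm_distC normN c x) => h1 h2; rewrite ltr_norml; lra.
Unshelve. all: by end_near. Qed.

Lemma rad_at_affine_le v t A c : finite_set A -> 0 <= t ->
  rad_at (affine_image v t A) (v + t *: c) <= t * rad_at A c.
Proof.
move=> fA t0; apply: rad_at_le; first exact: finite_affine_image.
  by rewrite mulr_ge0// rad_at_ge0.
move=> _ [y Ay <-]; rewrite opprD addrACA subrr add0r -scalerBr.
by rewrite is_norm_posZ// ler_wpM2l// le_rad_at.
Qed.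

Lemma rad_at_affine v t A c : finite_set A -> 0 < t ->
  rad_at (affine_image v t A) (v + t *: c) = t * rad_at A c.
Proof.
move=> fA t0; apply/eqP; rewrite eq_le rad_at_affine_le ?(ltW t0)//=.
have := @rad_at_affine_le (- (t^-1 *: v)) t^-1 (affine_image v t A) (v + t *: c).
rewrite affine_imageK ?gt_eqF// scalerDr scalerA mulVf ?gt_eqF// scale1r addKr.
rewrite invr_ge0 (ltW t0) ler_pdivlMl//.
by apply => //; exact: finite_affine_image.
Qed.

Lemma is_cheb_affine v t A c : finite_set A -> 0 < t ->
  is_cheb A c -> is_cheb (affine_image v t A) (v + t *: c).
Proof.
move=> fA t0 [hc cmin]; split; first exact: hull_affine.
move=> c' hc'; rewrite rad_at_affine//.
have {hc'} := @hull_affine (- (t^-1 *: v)) t^-1 _ _ hc'.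
rewrite affine_imageK ?gt_eqF// => hc'.
have -> : c' = v + t *: (- (t^-1 *: v) + t^-1 *: c').
  by rewrite scalerDr scalerN !scalerA divff ?gt_eqF// !scale1r addNKr.
by rewrite rad_at_affine// ler_pM2l// cmin.
Qed.

(** The points within [e] of [hull B] form a convex set containing [A], hence containing
    [hull A]. *)
Lemma hull_hausdorff e A B c : 0 <= e ->
  (forall a, A a -> exists2 b, B b & N (a - b) < e) ->
  hull A c -> exists2 c', hull B c' & N (c - c') <= e.
Proof.
move=> e0 AB /(_ [set c | exists2 c', hull B c' & N (c - c') <= e]); apply.
  move=> x y s s01 [x' hx xx'] [y' hy yy'].
  exists (s *: x' + (1 - s) *: y'); first exact: convex_hull.
  rewrite opprD addrACA -!scalerBr.
  apply: le_trans (is_norm_triangle normN _ _) _.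
  have [s0 s1] := andP s01; have s1' : 0 <= 1 - s by rewrite subr_ge0.
  rewrite !(is_norm_posZ normN)//.
  have := ler_wpM2l s0 xx'; have := ler_wpM2l s1' yy'; lra.
by move=> a /AB[b Bb ab]; exists b; [exact: sub_hull|exact: ltW].
Qed.

Lemma rad_at_hausdorff e A B c : finite_set A -> finite_set B -> 0 <= e ->
  (forall b, B b -> exists2 a, A a & N (a - b) < e) ->
  rad_at B c <= rad_at A c + e.
Proof.
move=> fA fB e0 AB; apply: rad_at_le; rewrite ?addr_ge0 ?rad_at_ge0// => b.
move=> /AB[a Aa ab]; have := le_rad_at c fA Aa.
by have := is_norm_dist_triangle normN a b c; rewrite (is_norm_distC normN b a); lra.
Qed.

Context (rotN : forall x y, N x = N y -> N y = N (2^-1 *: (x + y)) -> x = y).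

Lemma is_cheb_unique A c c' : finite_set A -> A !=set0 ->
  is_cheb A c -> is_cheb A c' -> c = c'.
Proof.
move=> fA [a Aa] [hc minc] [hc' minc'].
have rE : rad_at A c' = rad_at A c by apply/eqP; rewrite eq_le minc'// minc.
set r := rad_at A c in rE.
(* If the radius is 0, every point of [A] equals both centers. The midpoint argument below needs a
   positive radius to yield a strict inequality. *)
have [r0|r0] := leP r 0.
  have <- : a = c.
    by apply: (is_norm_eq normN); apply: le_trans (le_rad_at _ fA Aa) r0.
  by apply: (is_norm_eq normN); apply: le_trans (le_rad_at _ fA Aa) _; rewrite rE.
apply: contrapT => cc'.
set m := 2^-1 *: c + (1 - 2^-1) *: c'.
have hm : hull A m by apply: convex_hull => //; lra.
suff : rad_at A m < r by rewrite ltNge minc.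
apply: rad_at_lt => // t At.
have tm : t - m = 2^-1 *: ((t - c) + (t - c')).
  have half2 : 1 - 2^-1 = 2^-1 :> R by lra.
  rewrite /m half2 !scalerDr !scalerN addrACA -scalerDl opprD.
  by rewrite (_ : 2^-1 + 2^-1 = 1) ?scale1r//; lra.
have tc := le_rad_at c fA At; have tc' := le_rad_at c' fA At.
rewrite rE -/r in tc tc'.
have tri := is_norm_triangle normN (t - c) (t - c').
have E : N (t - m) = 2^-1 * N ((t - c) + (t - c')) by rewrite tm is_norm_posZ//; lra.
rewrite lt_neqAle; apply/andP; split; last by rewrite E; lra.
(* A point of [A] at distance exactly [r] from the midpoint is at distance [r] from both centers, by
   the triangle inequality; rotundity then identifies the two centers. *)
apply/eqP => tmr; apply: cc'.
have e1 : N (t - c) = r by lra.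
have e2 : N (t - c') = r by lra.
have : t - c = t - c' by apply: rotN; rewrite -?tm ?e1 ?e2.
by move=> /addrI/oppr_inj.
Qed.

Lemma chebP A : finite_set A -> A !=set0 -> is_cheb A (cheb A).
Proof.
move=> fA [a Aa]; have [|||c /set_mem hc cmin] := @compact_EVT_min V R (rad_at A) (hull A).
- by exists a; exact: sub_hull.
- exact: hull_compact.
- by apply: continuous_subspaceT; exact: rad_at_continuous.
apply: (@xgetI _ 0 _ c); split => // c' hc'.
by apply: cmin; exact/mem_set.
Qed.

Lemma cheb_affine v t A : finite_set A -> A !=set0 -> 0 < t ->
  cheb (affine_image v t A) = v + t *: cheb A.
Proof.
move=> fA A0 t0; apply: (@is_cheb_unique (affine_image v t A)).
- exact: finite_affine_image.
- exact: image_nonempty.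
- by apply: chebP; [exact: finite_affine_image|exact: image_nonempty].
- by apply: is_cheb_affine => //; exact: chebP.
Qed.

Lemma radius_affine v t A : finite_set A -> A !=set0 -> 0 < t ->
  radius (affine_image v t A) = t * radius A.
Proof. by move=> fA A0 t0; rewrite /radius cheb_affine// rad_at_affine. Qed.

Lemma radius_ge0 A : 0 <= radius A. Proof. exact: rad_at_ge0. Qed.

Lemma le_radius A t : finite_set A -> A t -> N (t - cheb A) <= radius A.
Proof. exact: le_rad_at. Qed.

Lemma radius_eq0 A : finite_set A -> A !=set0 -> radius A = 0 -> A = [set cheb A].
Proof.
move=> fA [a Aa] r0.
have E t : A t -> t = cheb A.
  by move=> At; apply: (is_norm_eq normN); rewrite -r0 le_radius.
by apply/seteqP; split=> [t /E//|_ ->]; rewrite -(E a Aa).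
Qed.

Lemma cheb1 x : cheb [set x] = x.
Proof.
have [h _] := @chebP [set x] (finite_set1 x) (ex_intro _ x erefl).
by apply: (h [set x]) => // _ _ s _ -> ->; rewrite -scalerDl addrC subrK scale1r.
Qed.

Lemma radius1 x : radius [set x] = 0.
Proof.
apply/eqP; rewrite eq_le radius_ge0 andbT /radius cheb1.
by apply: rad_at_le => // _ ->; rewrite subrr is_norm0.
Qed.

(** The center of [A] is within [e] of some point of [hull B]. Moving to that point costs one [e],
    replacing [A] by [B] costs another. *)
Lemma radius_hausdorff e A B : finite_set A -> finite_set B ->
  A !=set0 -> B !=set0 -> 0 <= e -> hausdorff_lt e A B ->
  radius B <= radius A + e + e.
Proof.
move=> fA fB A0 B0 e0 [AB BA]; have [hA _] := chebP fA A0.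
have [c' hc' cc'] := hull_hausdorff e0 AB hA.
have [_ /(_ _ hc') le1] := chebP fB B0.
have le2 := rad_at_hausdorff c' fA fB e0 BA.
have := rad_at_lipschitz (cheb A) c' fA.
rewrite is_norm_distC// => le3; rewrite -/(radius A) -/(radius B) in le1 le3; lra.
Qed.

Lemma hausdorff_lt_sym e A B : hausdorff_lt e A B -> hausdorff_lt e B A.
Proof.
move=> [AB BA]; split=> x.
  by move=> /BA[y Ay xy]; exists y => //; rewrite is_norm_distC.
by move=> /AB[y Ay xy]; exists y => //; rewrite is_norm_distC.
Qed.

(* The points of [hull A] at distance at least [e/2] from the center form a
   compact set on which [rad_at A] stays above [radius A]; the gap bounds how
   close [B] has to be to [A]. *)
Lemma cheb_hausdorff A e : finite_set A -> A !=set0 -> 0 < e ->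
  exists2 d, 0 < d & forall B, finite_set B -> B !=set0 -> hausdorff_lt d A B ->
    N (cheb A - cheb B) < e /\ `|radius A - radius B| < e.
Proof.
move=> fA A0 e0; have [hA minA] := chebP fA A0.
have [r' rr' r'P] : exists2 r', radius A < r' &
    forall c, hull A c -> e / 2 <= N (c - cheb A) -> r' <= rad_at A c.
  pose K := hull A `&` [set c | e / 2 <= N (c - cheb A)].
  have [K0|K0] := pselect (K !=set0); last first.
    exists (radius A + 1); first by lra.
    by move=> c hc ec; exfalso; apply: K0; exists c.
  have cK : compact K.
    apply: compact_closedI; first exact: hull_compact.
    have -> : [set c | e / 2 <= N (c - cheb A)] =
       rad_at [set cheb A] @^-1` [set x | e / 2 <= x].
      by apply/seteqP; split=> c /=; rewrite rad_at1 is_norm_distC.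
    by apply: closed_comp; [move=> c _; exact: rad_at_continuous|exact: closed_ge].
  have [|c /set_mem[hc ec] cmin] := @compact_EVT_min V R (rad_at A) K K0 cK.
    by apply: continuous_subspaceT; exact: rad_at_continuous.
  exists (rad_at A c); last by move=> c' hc' ec'; apply: cmin; exact/mem_set.
  rewrite lt_neqAle minA// andbT; apply/eqP => rE.
  move: ec => /=; suff -> : c = cheb A by rewrite subrr is_norm0//=; lra.
  apply: (is_cheb_unique fA A0) => //; split => // c' hc'.
  by rewrite -rE; exact: minA.
(* A point [c] of [hull A] within [d] of [cheb B] satisfies [rad_at A c <= radius A + 4 * d < r'],
   so it is within [e / 2] of [cheb A]. The bound [e / 8] absorbs the remaining distance from [c] to
   [cheb B]. *)
pose d := Num.min (e / 8) ((r' - radius A) / 8).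
have d0 : 0 < d by rewrite lt_min; apply/andP; split; lra.
have de : d <= e / 8 by rewrite ge_min lexx.
have dr : d <= (r' - radius A) / 8 by rewrite ge_min lexx orbT.
exists d => // B fB B0 AB; have [hB _] := chebP fB B0.
have AB1 := radius_hausdorff fA fB A0 B0 (ltW d0) AB.
have AB2 := radius_hausdorff fB fA B0 A0 (ltW d0) (hausdorff_lt_sym AB).
split; last by rewrite ltr_norml; lra.
have [c hc cc] := hull_hausdorff (ltW d0) (hausdorff_lt_sym AB).1 hB.
have le2 := rad_at_hausdorff c fB fA (ltW d0) (hausdorff_lt_sym AB).2.
have le3 := rad_at_lipschitz (cheb B) c fB.
rewrite -/(radius B) is_norm_distC// in le3.
have le4 := is_norm_dist_triangle normN c (cheb A) (cheb B).
rewrite (is_norm_distC normN (cheb A) c) (is_norm_distC normN c (cheb B)) in le4.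
have [/(r'P _ hc)|] := leP (e / 2) (N (c - cheb A)); lra.
Qed.

(* [d] is chosen so that [d * (2 + `|t| + M) <= e / 2], where [M] bounds the
   norm on [A]. *)
Lemma affine_image_hausdorff v t A e : finite_set A -> 0 < e ->
  exists2 d, 0 < d & forall v' t' B, N (v - v') < d -> `|t - t'| < d ->
    hausdorff_lt d A B -> hausdorff_lt e (affine_image v t A) (affine_image v' t' B).
Proof.
move=> fA e0; set M := rad_at A 0.
have M0 : 0 <= M by exact: rad_at_ge0.
have t0 : 0 <= `|t| by [].
pose K := 2 + `|t| + M; have K0 : 0 < K by rewrite /K; lra.
pose d := Num.min 1 (e / (2 * K)).
have d0 : 0 < d by rewrite lt_min ltr01 divr_gt0// mulr_gt0.
have d1 : d <= 1 by rewrite ge_min lexx.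
have dK : d * K <= e / 2.
  have : d <= e / (2 * K) by rewrite ge_min lexx orbT.
  by rewrite invfM mulrA -ler_pdivlMr.
exists d => // v' t' B vv tt [AB BA].
have key y y' : A y -> N (y - y') < d ->
    N ((v + t *: y) - (v' + t' *: y')) < e.
  move=> Ay yy.
  have -> : (v + t *: y) - (v' + t' *: y') =
      (v - v') + ((t - t') *: y + t' *: (y - y')).
    by rewrite opprD addrACA; congr (_ + _); rewrite scalerBl scalerBr addrA subrK.
  have h1 := is_norm_triangle normN (v - v') ((t - t') *: y + t' *: (y - y')).
  have h2 := is_norm_triangle normN ((t - t') *: y) (t' *: (y - y')).
  rewrite !(is_norm_homogeneous normN) in h2.
  have yM : N y <= M by have := le_rad_at 0 fA Ay; rewrite subr0.
  have h3 : `|t - t'| * N y <= d * M.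
    by apply: ler_pM => //; [exact: is_norm_ge0|exact: ltW].
  have tt' : `|t'| <= `|t| + 1.
    have := ler_normB t (t - t'); rewrite opprB addrCA subrr addr0; lra.
  have h4 : `|t'| * N (y - y') <= (`|t| + 1) * d.
    by apply: ler_pM => //; [exact: is_norm_ge0|exact: ltW].
  have : d * K = d * M + (`|t| + 1) * d + d by rewrite /K; ring.
  lra.
split=> [_ [y Ay <-]|_ [y By <-]].
  by have [y' By' yy] := AB _ Ay; exists (v' + t' *: y'); [exists y'|exact: key].
by have [y' Ay' yy] := BA _ By; exists (v + t *: y'); [exists y'|exact: key].
Qed.

End Chebyshev.

(** * Charts *)

Lemma open_embedding_comp (S T U : topologicalType) (f : S -> T) (g : T -> U) :
  open_embedding f -> open_embedding g -> open_embedding (g \o f).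
Proof.
move=> [cf jf of_] [cg jg og]; split.
- by move=> x; apply: continuous_comp; [exact: cf|exact: cg].
- exact: inj_comp.
- by move=> A oA; rewrite -image_comp; apply/og/of_.
Qed.

Lemma open_embedding_set_val (T : topologicalType) (U : set T) :
  open U -> open_embedding (set_val : U -> T).
Proof.
move=> oU; split; [exact: initial_continuous|exact: val_inj|].
move=> _ [B oB <-]; suff -> : set_val @` (set_val @^-1` B : set U) = B `&` U.
  exact: openI.
apply/seteqP; split=> [_ [[x xU] /= Bx <-]|x [Bx Ux]].
  by split => //; exact: set_mem xU.
by exists (SigSub (mem_set Ux)).
Qed.

Lemma open_embedding_homeomorphism (S T : topologicalType) (f : S -> T) g :
  continuous f -> continuous g -> cancel f g -> cancel g f -> open_embedding f.
Proof.
move=> cf cg fK gK; split => //; first exact: can_inj fK.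
move=> A oA; suff -> : f @` A = g @^-1` A by apply: open_comp => // x _; exact: cg.
apply/seteqP; split=> [_ [x Ax <-]|y /= Ay]; first by rewrite /= fK.
by exists (g y).
Qed.

Section BallChart.
Context {R : realType} {V : topologicalLmodType R} (N : V -> R).
Context (normN : is_norm N) (indN : induces_topology N).

Let norm_continuous (a z : V) : (fun y : V => N (y - a)) @ z --> N (z - a).
Proof.
move: z; rewrite -/(continuous _).
have -> : (fun z : V => N (z - a)) = rad_at N [set a].
  by apply/funext => y; rewrite (rad_at1 normN) (is_norm_distC normN).
exact: rad_at_continuous.
Qed.

(** The radial map [z |-> a + r z / (1 + N z)] sends the space onto the open ball, with inverse
    [y |-> (y - a) / (r - N (y - a))]. Openness follows from continuity of this inverse on the
    ball. *)
Lemma open_embedding_ball (a : V) (r : R) : 0 < r ->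
  exists b : V -> V,
    [/\ open_embedding b, b 0 = a & forall z, N (b z - a) < r].
Proof.
move=> r0.
pose b z := a + (r / (1 + N z)) *: z.
pose c y := (r - N (y - a))^-1 *: (y - a).
have N0 z : 0 <= N z by exact: is_norm_ge0.
have N1 z : 0 < 1 + N z by rewrite ltr_pwDl.
have rN z : 0 < r / (1 + N z) by rewrite divr_gt0.
have bN z : N (b z - a) = r / (1 + N z) * N z.
  by rewrite addrAC subrr add0r is_norm_posZ// ltW.
have rb z : r - N (b z - a) = r / (1 + N z) by rewrite bN; field; rewrite gt_eqF.
have bK : cancel b c.
  move=> z; rewrite /c rb invf_div /b addrAC subrr add0r scalerA.
  by rewrite mulrA divfK ?divff ?scale1r ?gt_eqF.
have cK y : N (y - a) < r -> b (c y) = y.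
  move=> yr; have n0 : 0 < r - N (y - a) by rewrite subr_gt0.
  have Nc : 1 + N (c y) = r / (r - N (y - a)).
    rewrite /c is_norm_posZ//; first by field; rewrite gt_eqF.
    by rewrite invr_ge0 ltW.
  rewrite /b Nc invf_div mulrC divfK ?gt_eqF// /c scalerA divff ?gt_eqF// scale1r.
  by rewrite addrC subrK.
have bc : continuous b.
  move=> z; apply: tlmod_cvgD; first exact: cvg_cst.
  apply: tlmod_cvgZ; last exact: cvg_id.
  apply: cvgM; first exact: cvg_cst.
  apply: cvgV; [by rewrite gt_eqF|apply: cvgD]; first exact: cvg_cst.
  have := @norm_continuous 0 z; rewrite subr0.
  by under eq_fun do rewrite subr0.
exists b; split; last first.
- by move=> z; rewrite bN mulrAC ltr_pdivrMr// ltr_pM2l// ltrDr.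
- by rewrite /b scaler0 addr0.
split => //; first exact: can_inj bK.
move=> A oA; rewrite openE => _ [z Az <-].
have cc : {for b z, continuous c}.
  apply: tlmod_cvgZ; last first.
    by apply: tlmod_cvgD; [exact: cvg_id|exact: cvg_cst].
  apply: cvgV.
    by rewrite rb gt_eqF.
  by apply: cvgB; [exact: cvg_cst|exact: norm_continuous].
have /cc cA : nbhs (c (b z)) A by rewrite bK; exact: open_nbhs_nbhs.
have br : \forall y \near b z, N (y - a) < r.
  apply: (cvgr_lt (N (b z - a)) (@norm_continuous a (b z))).
  by rewrite bN mulrAC ltr_pdivrMr// ltr_pM2l// ltrDr.
have : nbhs (b z) (c @^-1` A `&` [set y | N (y - a) < r]) by exact: filterI.
by apply: filterS => y [Acy yr]; exists (c y) => //; exact: cK.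
Qed.

End BallChart.

(* A ball is homeomorphic to the whole space, hence charts can be shrunk into any
   given open set. *)
Lemma rotund_chart (R : realType) (X : topologicalType) (x : X) (W : set X) :
  locally_rotund R X -> open W -> W x ->
  exists (V : topologicalLmodType R) (psi : V -> X),
    [/\ rotund V, open_embedding psi, psi 0 = x & range psi `<=` W].
Proof.
move=> /(_ x)[U [V [[oU Ux] rV [f [g [cf cg fK gK]]]]]] oW Wx.
have gE := open_embedding_comp (open_embedding_homeomorphism cg cf gK fK)
  (open_embedding_set_val oU).
pose a := f (SigSub (mem_set Ux)).
have ga : (set_val \o g) a = x by rewrite /= /a fK.
have [N [normN indN _]] := rV.
have [cgE _ _] := gE.
have : nbhs a ((set_val \o g) @^-1` W).
  by apply: cgE; rewrite ga; exact: open_nbhs_nbhs.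
move=> /indN[r r0 rW].
have [b [bE b0 br]] := open_embedding_ball normN indN a r0.
exists V, ((set_val \o g) \o b); split => //.
- exact: open_embedding_comp.
- by rewrite /= b0.
- by move=> _ [z _ <-]; apply: rW; exact: br.
Qed.


(** * Neighbourhoods in subspaces, cones and the exponential *)

Lemma nbhs_set_type (T : topologicalType) (A : set T) (x : A) (B : set A) :
  nbhs x B <-> exists2 C, nbhs (set_val x) C & set_val @^-1` C `<=` B.
Proof.
split=> [|[C xC CB]]; last first.
  by apply: filterS CB _; exact: (@initial_continuous A T set_val x).
rewrite nbhsE => -[_ [[C oC <-] Cx] CB]; exists C => //.
by exists C.
Qed.

Section ConeTopology.
Context {R : realType} {L : topologicalType}.

Lemma nbhs_cone_some (x : (`]0, +oo[%classic : set R) * L)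
    (B : set (open_cone R L)) :
  nbhs (Some x : open_cone R L) B <-> nbhs x (Some @^-1` B).
Proof.
split.
  rewrite nbhsE => -[C [[oC _] Cx] CB].
  by apply: filterS (open_nbhs_nbhs (conj oC Cx)) => z /CB.
(* An image under [Some] misses the tip, so the tip clause of the cone topology is vacuous for
   it. *)
move=> xB; rewrite nbhsE; exists (Some @` (Some @^-1` B)^°).
  split; last by exists x.
  split; last by case.
  have -> : Some @^-1` ((Some : _ -> open_cone R L) @` (Some @^-1` B)^°) =
      (Some @^-1` B)^°.
    by apply/seteqP; split=> [z [_ + [<-]]//|z Bz]; exists z.
  exact: open_interior.
by move=> _ [z zB <-]; exact: nbhs_singleton zB.
Qed.

Lemma nbhs_cone_tip (B : set (open_cone R L)) :
  nbhs (cone_tip R L) B <-> B (cone_tip R L) /\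
    exists2 e : R, 0 < e & forall (t : (`]0, +oo[%classic : set R)) (l : L),
       set_val t < e -> B (Some (t, l)).
Proof.
split=> [|[B0 [e e0 Be]]].
  rewrite nbhsE => -[C [[oC tC] C0] CB]; split; first exact: CB.
  by have [e e0 Ce] := tC C0; exists e => // t l /Ce - /(_ l)/CB.
pose C : set (open_cone R L) :=
  [set c | if c is Some (t, _) then set_val t < e else True].
rewrite nbhsE; exists C; last by move=> [[t l] /Be|_ //]; exact.
split => //; split; last by move=> _; exists e.
have -> : Some @^-1` C = fst @^-1` (set_val @^-1` [set x | x < e]).
  by apply/seteqP; split=> -[].
apply: open_comp; first by move=> z _; exact: cvg_fst.
by exists [set x | x < e] => //; exact: open_lt.
Qed.

End ConeTopology.

Section Vietoris.
Context {X : topologicalType}.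

(** A basic open set indexed by the points of [S] rather than by a family of opens; only the values
    of [W] on [S] matter. *)
Definition vietoris_box (S : metric_exp X) (W : X -> set X) : set (metric_exp X) :=
  [set T : {fset X} | [set` T] `<=` \bigcup_(s in [set` (S : {fset X})]) W s /\
     forall s, s \in (S : {fset X}) -> [set` T] `&` W s !=set0].

Lemma open_vietoris_box (S : metric_exp X) (W : X -> set X) :
  (forall s, s \in (S : {fset X}) -> open (W s)) -> open (vietoris_box S W).
Proof.
move=> oW; pose F : set (set X) := W @` [set` (S : {fset X})].
have -> : vietoris_box S W = exp_open F.
  apply/seteqP; split=> T [TS ST]; split.
  - by move=> t /TS[s Ss Wt]; exists (W s) => //; exists s.
  - by move=> _ [s Ss <-]; exact: ST.
  - by move=> t /TS[_ [s Ss <-] Wt]; exists s.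
  - by move=> s Ss; apply: ST; exists s.
exists [set exp_open F]; last by rewrite bigcup_set1.
move=> _ ->; exists [fset F]%fset.
  move=> G /fset1P ->; apply/mem_set; split.
    exact: finite_image.
  by move=> _ [s Ss <-]; exact: oW.
by apply/seteqP; split=> T => [|TF G]; [apply; exact/fset1P|move=> /fset1P ->].
Qed.

Lemma nbhs_metric_expP (S : metric_exp X) (A : set (metric_exp X)) :
  nbhs S A <-> exists2 W : X -> set X,
    (forall s, s \in (S : {fset X}) -> nbhs s (W s)) & vietoris_box S W `<=` A.
Proof.
split=> [|[W nW WA]]; last first.
  rewrite nbhsE; exists (vietoris_box S (fun s => (W s)^°)).
    split; first by apply: open_vietoris_box => s _; exact: open_interior.
    split=> [s Ss|s Ss]; [exists s => //|exists s; split => //]; exact: nW.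
  move=> T [TS ST]; apply: WA; split.
    by move=> t /TS[s Ss /nbhs_singleton Wt]; exists s.
  by move=> s /ST[t [Tt /nbhs_singleton Wt]]; exists t.
rewrite nbhsE => -[_ [[Fs FsD <-] [G FsG GS]] FsA].
have [D Dop GE] := FsD _ FsG.
have DS : (\bigcap_(F in [set` D]) exp_open F) S by rewrite [X in X S]GE.
(* [W s] intersects all the members containing [s] of the finitely many families defining the given
   neighbourhood. *)
pose W s := \bigcap_(F in [set` D]) \bigcap_(U in F `&` [set U | U s]) U.
exists W => [s Ss|T [TS ST]].
  apply: filter_bigI => F FD; have /set_mem[Ffin Fop] := Dop _ FD.
  have /finite_fsetP[K FK] : finite_set (F `&` [set U | U s]).
    exact: sub_finite_set Ffin.
  rewrite FK; apply: filter_bigI => U UK.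
  have [FU Us] : (F `&` [set U | U s]) U by rewrite FK.
  by apply: open_nbhs_nbhs; split => //; exact: Fop.
apply: FsA; exists G => //.
suff : (\bigcap_(F in [set` D]) exp_open F) T by rewrite [X in X T]GE.
move=> F FD.
have [SF FS] := DS _ FD; split=> [t /TS[s Ss /(_ _ FD) Wst]|U FU].
  by have [U FU Us] := SF _ Ss; exists U => //; apply: Wst.
have [s [Ss Us]] := FS _ FU; have [t [Tt Wst]] := ST _ Ss.
by exists t; split => //; apply: (Wst _ FD).
Qed.

End Vietoris.


(** * The exponential of a disjoint union of charts *)

Lemma pos_lower_bound (R : realType) (T : eqType) (s : seq T) (f : T -> R) :
  (forall x, x \in s -> 0 < f x) ->
  exists2 e, 0 < e & forall x, x \in s -> e <= f x.
Proof.
elim: s => [|x s IH] fs; first by exists 1.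
have [y ys|e e0 es] := IH; first by apply: fs; rewrite inE ys orbT.
exists (Num.min (f x) e); first by rewrite lt_min e0 fs// mem_head.
move=> y; rewrite inE => /predU1P[->|/es ye]; first by rewrite ge_min lexx.
by rewrite ge_min ye orbT.
Qed.

(** Choosing a related [a] for each [b] gives an injection of [B] into [A]. A relation serves where
    the map from [A] to [B] is only described in chart coordinates. *)
Lemma card_fset_le_rel (T T' : choiceType) (A : {fset T}) (B : {fset T'})
    (Q : T -> T' -> Prop) :
  (forall b, b \in B -> exists2 a, a \in A & Q a b) ->
  (forall a b b', Q a b -> Q a b' -> b = b') ->
  (#|` B| <= #|` A|)%N.
Proof.
move=> BA Qfun.
have [->|[b0 b0B]] := fset_0Vmem B; first by rewrite cardfs0.
have [a0 _ _] := BA _ b0B.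
pose g b := xget a0 [set a | a \in A /\ Q a b].
have gP b : b \in B -> g b \in A /\ Q (g b) b.
  by move=> /BA[a aA Qab]; apply: (@xgetI _ a0 [set a | a \in A /\ Q a b] a).
have <- : #|` (g @` B)%fset| = #|` B|.
  apply: card_in_imfset => b b' /gP[_ Qb] /gP[_ Qb'] gg.
  by apply: (Qfun (g b)) => //; rewrite gg.
apply: fsubset_leq_card; apply/fsubsetP => _ /imfsetP[b bB ->].
by have [] := gP _ bB.
Qed.

Section Charts.
Context {R : realType} {X : topologicalType} {I : finType}.
Context {V : I -> topologicalLmodType R} (N : forall i, V i -> R).
Context (psi : forall i, V i -> X).
Arguments N : clear implicits.
Arguments psi : clear implicits.
Context (normN : forall i, is_norm (N i)).
Context (indN : forall i, induces_topology (N i)).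
Context (rotN : forall i x y,
  N i x = N i y -> N i y = N i (2^-1 *: (x + y)) -> x = y).
Arguments indN : clear implicits.
Arguments rotN : clear implicits.
Context (psiE : forall i, open_embedding (psi i)).
Context (psi_disjoint : forall i j x y, psi i x = psi j y -> i = j).

Let psi_inj i : injective (psi i). Proof. by have [] := psiE i. Qed.

Definition trace (T : metric_exp X) (i : I) : set (V i) :=
  psi i @^-1` [set` (T : {fset X})].
Arguments trace : clear implicits.

(** When [I] is empty only the empty set is charted, which matches the isolated element 0 of
    [omega_star]. *)
Definition charted : set (metric_exp X) :=
  [set T : {fset X} | (forall x, x \in T -> exists i v, x = psi i v) /\
                      forall i, trace T i !=set0].

Definition glue (A : forall i, set (V i)) : metric_exp X :=
  fset_set (\bigcup_(i in [set: I]) psi i @` A i).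

Definition close_exp (e : R) (T T' : metric_exp X) : Prop :=
  forall i, hausdorff_lt (N i) e (trace T i) (trace T' i).

Lemma finite_trace T i : finite_set (trace T i).
Proof. by apply: finite_preimage => // x y _ _; exact: psi_inj. Qed.

Lemma trace_nonempty T i : charted T -> trace T i !=set0.
Proof. by case. Qed.

Lemma in_glue A x : (forall i, finite_set (A i)) ->
  reflect (exists i v, A i v /\ x = psi i v) (x \in (glue A : {fset X})).
Proof.
move=> fA; rewrite in_fset_set; last first.
  by apply: bigcup_finite => // i _; exact: finite_image.
apply: (iffP idP) => [|[i [v [Av ->]]]]; rewrite inE.
  by move=> [i _ [v Av <-]]; exists i, v.
by exists i => //; exists v.
Qed.

Lemma trace_glue A i : (forall i, finite_set (A i)) -> trace (glue A) i = A i.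
Proof.
move=> fA; apply/seteqP; split=> v; rewrite /trace/=.
  move=> /(in_glue _ fA)[j [w [Aw E]]].
  have ij := psi_disjoint E; subst j; by rewrite (psi_inj E).
by move=> Av; apply/in_glue => //; exists i, v.
Qed.

Lemma charted_glue A : (forall i, finite_set (A i)) -> (forall i, A i !=set0) ->
  charted (glue A).
Proof.
move=> fA A0; split=> [x /(in_glue _ fA)[i [v [_ ->]]]|i]; first by exists i, v.
by rewrite trace_glue.
Qed.

Lemma charted_inj T T' : charted T -> charted T' ->
  (forall i, trace T i = trace T' i) -> T = T'.
Proof.
have sub S S' : charted S -> (forall i, trace S i = trace S' i) ->
    {subset (S : {fset X}) <= (S' : {fset X})}.
  move=> [cS _] E x Sx; have [i [v xE]] := cS _ Sx; subst x.
  by have : trace S i v by []; rewrite E.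
move=> cT cT' E; apply/fsetP => x; apply/idP/idP; first exact: sub.
by apply: sub => // i; rewrite E.
Qed.

(** Among charted sets the topology of the exponential is that of the Hausdorff distance, taken
    chart by chart. Finiteness of [T] provides a single [e], and disjointness of the charts lets
    points be compared within one chart. *)
Lemma nbhs_chartedP T (A : set (metric_exp X)) : charted T ->
  nbhs T A <-> exists2 e, 0 < e &
    forall T', charted T' -> close_exp e T T' -> A T'.
Proof.
move=> [Tpsi T0]; rewrite nbhs_metric_expP; split=> [[W nW WA]|[e e0 eA]].
  (* [f x] is the radius of a ball, in the chart of [x], that is sent into [W x]; its value off [T]
     is irrelevant. *)
  have /choice[f fP] : forall x, exists e, x \in (T : {fset X}) -> 0 < e /\
      forall i v, x = psi i v -> forall w, N i (v - w) < e -> W x (psi i w).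
    move=> x; have [xT|xT] := boolP (x \in (T : {fset X})); last by exists 0.
    have [i [v xE]] := Tpsi _ xT; subst x.
    have [cpsi _ _] := psiE i.
    have /indN[e e0 eW] : nbhs v (psi i @^-1` W (psi i v)) by apply: cpsi; exact: nW.
    exists e => _; split => // j w E; have ij := psi_disjoint E; subst j.
    move: E => /psi_inj <- u vu; apply: eW => /=.
    by rewrite (is_norm_distC (normN i)).
  have [|e e0 ef] := @pos_lower_bound R X (enum_fset (T : {fset X})) f.
    by move=> x /fP[].
  exists e => // T' [T'psi T'0] TT'; apply: WA; split.
    move=> x xT'; have [i [w xE]] := T'psi _ xT'; subst x.
    have [v Tv vw] := (TT' i).2 _ xT'.
    exists (psi i v) => //; have [_ /(_ i v erefl w)] := fP _ Tv; apply.
    exact: lt_le_trans vw (ef _ Tv).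
  move=> s sT; have [i [v sE]] := Tpsi _ sT; subst s.
  have [w T'w vw] := (TT' i).1 _ sT.
  exists (psi i w); split => //; have [_ /(_ i v erefl w)] := fP _ sT; apply.
  exact: lt_le_trans vw (ef _ sT).
(* The converse uses the box of images of [e]-balls: its members are charted, since they lie in the
   charts and meet each of them. *)
pose W s := [set x | exists i v w, [/\ s = psi i v, x = psi i w & N i (v - w) < e]].
exists W.
  move=> s sT; have [i [v sE]] := Tpsi _ sT; subst s.
  have [_ _ opsi] := psiE i.
  have vO : nbhs v [set w | N i (v - w) < e].
    by apply/indN; exists e => // w /=; rewrite (is_norm_distC (normN i)).
  have : nbhs (psi i v) (psi i @` [set w | N i (v - w) < e]^°).
    apply: open_nbhs_nbhs; split; first by apply: opsi; exact: open_interior.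
    by exists v.
  apply: filterS => _ [w /nbhs_singleton vw <-].
  by exists i, v, w.
move=> T' [T'T TT'].
have fw i v : trace T i v -> exists2 w, trace T' i w & N i (v - w) < e.
  move=> /TT'[x [T'x [j [v' [w [E xE vw]]]]]]; subst x.
  have ij := psi_disjoint E; subst j.
  by exists w => //; rewrite (psi_inj E).
have bw i w : trace T' i w -> exists2 v, trace T i v & N i (v - w) < e.
  move=> /T'T[s sT [j [v [w' [sE E vw]]]]]; subst s.
  have ij := psi_disjoint E; subst j.
  by exists v => //; rewrite (psi_inj E).
apply: eA; last by move=> i; split; [exact: fw|exact: bw].
split=> [x /T'T[s sT [j [v [w' [sE E vw]]]]]|i]; first by exists j, w'.
by have [v /fw[w]] := T0 i; exists w.
Qed.

Lemma nbhs_charted T : charted T -> nbhs T charted.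
Proof. by move=> cT; apply/nbhs_chartedP => //; exists 1. Qed.

Lemma open_charted : open charted.
Proof. by rewrite openE => T; exact: nbhs_charted. Qed.

Lemma card_glue1 (c : forall i, V i) :
  #|` (glue (fun i => [set c i]) : {fset X})| = #|I|.
Proof.
have -> : glue (fun i => [set c i]) = [fset psi i (c i) | i in I]%fset.
  apply/fsetP => x; apply/(in_glue _ _)/imfsetP => [i|[i [_ [-> ->]]]|[i _ ->]].
  - exact: finite_set1.
  - by exists i.
  - by exists i, (c i).
rewrite card_imfset; last by move=> i j /psi_disjoint.
by rewrite cardE.
Qed.

Lemma glue_sub (A B : forall i, set (V i)) :
  (forall i, finite_set (B i)) -> (forall i, A i `<=` B i) ->
  ((glue A : {fset X}) `<=` (glue B : {fset X}))%fset.
Proof.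
move=> fB AB; apply/fsubsetP => x /in_glue[i|i [v [/AB Bv ->]]].
  exact: sub_finite_set (AB i) (fB i).
by apply/in_glue => //; exists i, v.
Qed.

Lemma glue_trace T : charted T -> glue (trace T) = T.
Proof.
move=> cT; have fT := finite_trace T.
apply: charted_inj => //; last by move=> i; exact: trace_glue.
by apply: charted_glue => // i; exact: trace_nonempty.
Qed.


Lemma card_charted T : charted T -> (#|I| <= #|` (T : {fset X})|)%N.
Proof.
move=> cT; have /fin_all_exists[c Tc] := fun i => trace_nonempty i cT.
rewrite -(card_glue1 c) -(glue_trace cT); apply: fsubset_leq_card.
by apply: glue_sub => i; [exact: finite_trace|move=> _ ->; exact: Tc].
Qed.

(** One point chosen in each chart already gives a subset of [T] with as many elements as [T], so it
    is all of [T]. *)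
Lemma trace_singleton T i : charted T -> #|` (T : {fset X})| = #|I| ->
  trace T i = [set cheb (N i) (trace T i)].
Proof.
move=> cT cardT; have /fin_all_exists[c Tc] := fun i => trace_nonempty i cT.
have sub : (glue (fun i => [set c i]) `<=` (T : {fset X}))%fset.
  rewrite -(glue_trace cT).
  by apply: glue_sub => j; [exact: finite_trace|move=> _ ->; exact: Tc].
have TE : glue (fun i => [set c i]) = T.
  by apply/eqP; rewrite eqEfcard sub card_glue1 cardT leqnn.
rewrite -{1 2}TE trace_glue; last by move=> j; exact: finite_set1.
by rewrite (cheb1 (normN i) (indN i)).
Qed.

Lemma card_singletons T (c : forall i, V i) : charted T ->
  (forall i, trace T i = [set c i]) -> #|` (T : {fset X})| = #|I|.
Proof.
move=> cT Tc; rewrite -(card_glue1 c) -(glue_trace cT).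
by congr (#|` (glue _ : {fset X})|); apply: functional_extensionality_dep.
Qed.

Lemma exp_card_le_charted S T : charted S -> charted T ->
  #|` (S : {fset X})| = #|I| -> (exp_card S <= exp_card T)%O.
Proof.
move=> cS cT cardS; rewrite /Order.le/= /omega_star_le /exp_card cardS.
(* In [omega_star] the element 0 is below itself only, so for empty [I] it has to be shown that [T]
   is empty. *)
rewrite card_charted// andbT; have [I0|_] := posnP #|I|; last by rewrite orbT.
rewrite orbF eq_sym I0.
rewrite cardfs_eq0; apply/eqP/fsetP => x; rewrite inE; apply/negP.
move=> /(proj1 cT)[i _]; move: (I0) => /card0_eq/(_ i).
by rewrite inE.
Qed.

(** * Translations and dilations in the charts *)

Definition move_exp (v : forall i, V i) (t : R) (T : metric_exp X) : metric_exp X :=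
  glue (fun i => affine_image (v i) t (trace T i)).

Lemma trace_move v t T i : trace (move_exp v t T) i = affine_image (v i) t (trace T i).
Proof.
by rewrite trace_glue// => j; apply: finite_affine_image; exact: finite_trace.
Qed.

Lemma charted_move v t T : charted T -> charted (move_exp v t T).
Proof.
move=> cT; apply: charted_glue => i.
  by apply: finite_affine_image; exact: finite_trace.
by apply: image_nonempty; exact: trace_nonempty.
Qed.

Lemma move_expK v t T : t != 0 -> charted T ->
  move_exp (fun i => - (t^-1 *: v i)) t^-1 (move_exp v t T) = T.
Proof.
move=> t0 cT; apply: charted_inj => //; first exact/charted_move/charted_move.
by move=> i; rewrite !trace_move affine_imageK.
Qed.

Lemma card_move_le v t T : charted T ->
  (#|` (move_exp v t T : {fset X})| <= #|` (T : {fset X})|)%N.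
Proof.
move=> cT; apply: (@card_fset_le_rel _ _ _ _ (fun x x' =>
    exists i y, x = psi i y /\ x' = psi i (v i + t *: y))).
  move=> x' x'T; have [i [w x'E]] := (charted_move v t cT).1 _ x'T.
  have : trace (move_exp v t T) i w by rewrite /trace/= -x'E.
  rewrite trace_move => -[y Ty yw]; exists (psi i y) => //.
  by exists i, y; rewrite yw.
move=> x _ _ [i [y [-> ->]]] [j [z [E ->]]].
by have ij := psi_disjoint E; subst j; rewrite (psi_inj E).
Qed.

(** The inequality of [card_move_le] is applied both to the motion and to its inverse. *)
Lemma card_move v t T : t != 0 -> charted T ->
  #|` (move_exp v t T : {fset X})| = #|` (T : {fset X})|.
Proof.
move=> t0 cT; apply/eqP; rewrite eqn_leq card_move_le//=.
rewrite -{1}(move_expK v t0 cT); apply: card_move_le; exact: charted_move.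
Qed.

(** * Centers and width of a charted set *)

Definition center (T : metric_exp X) (i : I) : V i := cheb (N i) (trace T i).
Arguments center : clear implicits.

Definition width (T : metric_exp X) : R :=
  \big[Num.max/0]_(i : I) radius (N i) (trace T i).

Lemma le_width T i : radius (N i) (trace T i) <= width T.
Proof. exact: (le_bigmax _ (fun i => radius (N i) (trace T i))). Qed.

Lemma width_ge0 T : 0 <= width T.
Proof. by rewrite /width bigmax_idl le_max lexx. Qed.

Lemma width_le T r : 0 <= r -> (forall i, radius (N i) (trace T i) <= r) ->
  width T <= r.
Proof. by move=> r0 Tr; apply: bigmax_le. Qed.

Lemma width_eq0 T i : charted T -> width T = 0 -> trace T i = [set center T i].
Proof.
move=> cT T0; apply: (radius_eq0 (normN i)); first exact: finite_trace.
  exact: trace_nonempty.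
by apply/eqP; rewrite eq_le radius_ge0 andbT -T0 le_width.
Qed.

(** Width 0 means one point in each chart. This identifies the lowest stratum of the neighbourhood
    with the locus sent to the tip of the cone. *)
Lemma width0_card T : charted T -> width T = 0 <-> #|` (T : {fset X})| = #|I|.
Proof.
move=> cT; split=> [T0|cardT].
  by apply: (@card_singletons _ (center T)) => // i; exact: width_eq0.
apply/eqP; rewrite eq_le width_ge0 andbT; apply: width_le => // i.
by rewrite trace_singleton// (radius1 (normN i) (indN i)).
Qed.

Lemma center_move v t T i : charted T -> 0 < t ->
  center (move_exp v t T) i = v i + t *: center T i.
Proof.
move=> cT t0; rewrite /center trace_move.
rewrite (cheb_affine (normN i) (indN i) (rotN i))//; first exact: finite_trace.
exact: trace_nonempty.
Qed.

Lemma width_move v t T : charted T -> 0 < t -> width (move_exp v t T) = t * width T.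
Proof.
move=> cT t0.
have rE i : radius (N i) (trace (move_exp v t T) i) = t * radius (N i) (trace T i).
  rewrite trace_move (radius_affine (normN i) (indN i) (rotN i))//.
    exact: finite_trace.
  exact: trace_nonempty.
apply/eqP; rewrite eq_le; apply/andP; split.
  apply: width_le => [|i]; first by rewrite mulr_ge0 ?width_ge0// ltW.
  by rewrite rE ler_pM2l// le_width.
rewrite -ler_pdivlMl//; apply: width_le => [|i].
  by rewrite mulr_ge0 ?width_ge0// invr_ge0 ltW.
by rewrite ler_pdivlMl// -rE le_width.
Qed.

Lemma close_exp_le e e' T T' : e <= e' -> close_exp e T T' -> close_exp e' T T'.
Proof. by move=> ee' TT' i; exact: hausdorff_lt_le (TT' i). Qed.

Lemma fin_pos_lower_bound (P : I -> R -> Prop) :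
  (forall i, exists2 d, 0 < d & P i d) ->
  (forall i d d', 0 < d' -> d' <= d -> P i d -> P i d') ->
  exists2 d, 0 < d & forall i, P i d.
Proof.
move=> Pd Pmon.
have /fin_all_exists[f fP] : forall i, exists d, 0 < d /\ P i d.
  by move=> i; have [d d0 Pi] := Pd i; exists d.
have [|d d0 df] := @pos_lower_bound R I (index_enum I) f; first by move=> i _; case: (fP i).
exists d => // i; apply: (Pmon i (f i)) => //; last by case: (fP i).
by apply: df; rewrite mem_index_enum.
Qed.

Lemma center_width_continuous T e : charted T -> 0 < e ->
  exists2 d, 0 < d & forall T', charted T' -> close_exp d T T' ->
    (forall i, N i (center T i - center T' i) < e) /\ `|width T - width T'| < e.
Proof.
move=> cT e0; have e20 : 0 < e / 2 by rewrite divr_gt0.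
(* A uniform [d] over the charts with bound [e / 2]; the slack keeps the final inequality between
   the maxima strict. *)
have [| |d d0 dP] := @fin_pos_lower_bound (fun i d => forall B, finite_set B ->
    B !=set0 -> hausdorff_lt (N i) d (trace T i) B ->
    N i (center T i - cheb (N i) B) < e / 2 /\
    `|radius (N i) (trace T i) - radius (N i) B| < e / 2).
- move=> i; apply: (cheb_hausdorff (normN i) (indN i) (rotN i)) => //.
  exact: finite_trace.
  exact: trace_nonempty.
- by move=> i d d' _ dd' dP B fB B0 /(hausdorff_lt_le dd'); exact: dP.
exists d => // T' cT' TT'.
have {}dP i := dP i _ (finite_trace T' i) (trace_nonempty i cT') (TT' i).
split=> [i|]; first by have [+ _] := dP i; rewrite -/(center T' i); lra.
have rad_bound i : `|radius (N i) (trace T i) - radius (N i) (trace T' i)| <= e / 2.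
  by have [_ /ltW] := dP i.
have le1 : width T <= width T' + e / 2.
  apply: width_le => [|i]; first by have := width_ge0 T'; lra.
  by have := le_width T' i; have := rad_bound i; rewrite ler_norml; lra.
have le2 : width T' <= width T + e / 2.
  apply: width_le => [|i]; first by have := width_ge0 T; lra.
  by have := le_width T i; have := rad_bound i; rewrite ler_norml; lra.
by rewrite ltr_norml; lra.
Qed.

Lemma move_continuous v t T e : 0 < e ->
  exists2 d, 0 < d & forall v' t' T', (forall i, N i (v i - v' i) < d) ->
    `|t - t'| < d -> close_exp d T T' ->
    close_exp e (move_exp v t T) (move_exp v' t' T').
Proof.
move=> e0.
have [| |d d0 dP] := @fin_pos_lower_bound (fun i d => forall v' t' B,
    N i (v i - v') < d -> `|t - t'| < d -> hausdorff_lt (N i) d (trace T i) B ->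
    hausdorff_lt (N i) e (affine_image (v i) t (trace T i)) (affine_image v' t' B)).
- move=> i; apply: (affine_image_hausdorff (normN i)) => //.
  exact: finite_trace.
- move=> i d d' _ dd' dP v' t' B vv tt /(hausdorff_lt_le dd').
  by apply: dP; [exact: lt_le_trans vv dd'|exact: lt_le_trans tt dd'].
exists d => // v' t' T' vv tt TT' i; rewrite !trace_move; exact: dP.
Qed.


Lemma nbhs_charted_subset (A : set (metric_exp X)) (T : A) (B : set A) :
  A `<=` charted -> nbhs T B <->
  exists2 e, 0 < e & forall T' : A, close_exp e (set_val T) (set_val T') -> B T'.
Proof.
move=> Ac; have cA (S : A) : charted (set_val S) by apply: Ac; exact: set_valP.
rewrite nbhs_set_type; split=> [[C /(nbhs_chartedP _ (cA T))[e e0 eC] CB]|[e e0 eB]].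
  by exists e => // T' TT'; apply: CB; exact: eC.
exists [set T' | forall x : A, set_val x = T' -> B x]; last by move=> x; exact.
apply/nbhs_chartedP => //; exists e => // T' _ TT' x xE.
by apply: eB; rewrite xE.
Qed.

(** * The conical chart *)

Definition link : set (metric_exp X) :=
  [set T | [/\ charted T, forall i, center T i = 0 & width T = 1]].

Lemma link_charted : link `<=` charted. Proof. by move=> T []. Qed.

Lemma link_norm_le (T : metric_exp X) i y : link T -> trace T i y -> N i y <= 1.
Proof.
move=> [cT T0 T1] Ty; rewrite -[y]subr0 -(T0 i) -T1.
apply: le_trans (le_width T i).
by apply: le_radius => //; exact: finite_trace.
Qed.

(** The link coordinate of [T]: centers are first translated to 0, then the set is rescaled to width
    1. It is meaningful for positive width. *)
Definition normalize (T : metric_exp X) : metric_exp X :=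
  move_exp (fun i => 0) (width T)^-1 (move_exp (fun i => - center T i) 1 T).

Lemma affine_image_comp i (v w : V i) (s t : R) (A : set (V i)) :
  affine_image v s (affine_image w t A) = affine_image (v + s *: w) (s * t) A.
Proof.
rewrite /affine_image image_comp; congr (_ @` A); apply/funext => y /=.
by rewrite scalerDr scalerA addrA.
Qed.

Lemma affine_image01 i (A : set (V i)) : affine_image 0 1 A = A.
Proof.
apply/seteqP; split=> [_ [y Ay <-]|y Ay]; first by rewrite add0r scale1r.
by exists y => //; rewrite add0r scale1r.
Qed.

Lemma link_normalize T : charted T -> 0 < width T -> link (normalize T).
Proof.
move=> cT T0; have T0' : 0 < (width T)^-1 by rewrite invr_gt0.
have c1 := charted_move (fun i => - center T i) 1 cT.
split; first exact: charted_move.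
  move=> i; rewrite !center_move// scale1r [- _ + _]addrC subrr scaler0 addr0//.
by rewrite !width_move// mul1r mulVf// gt_eqF.
Qed.

Lemma move_normalize T : charted T -> 0 < width T ->
  move_exp (center T) (width T) (normalize T) = T.
Proof.
move=> cT T0; apply: charted_inj => //; first by do 3 apply: charted_move.
move=> i; rewrite !trace_move !affine_image_comp scaler0 addr0.
by rewrite divff ?gt_eqF// mulr1 scale1r subrr affine_image01.
Qed.

Lemma normalize_move v t T : link T -> 0 < t -> normalize (move_exp v t T) = T.
Proof.
move=> [cT T0 T1] t0; apply: charted_inj => //; first by do 3 apply: charted_move.
move=> i; rewrite !trace_move !affine_image_comp width_move// T1.
rewrite center_move// T0 scaler0 addr0 add0r !mulr1 -scalerDr addNr scaler0.
by rewrite mulVf ?gt_eqF// affine_image01.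
Qed.

Lemma normalize_continuous T e : charted T -> 0 < width T -> 0 < e ->
  exists2 d, 0 < d & forall T', charted T' -> close_exp d T T' ->
    close_exp e (normalize T) (normalize T').
Proof.
move=> cT T0 e0.
have [d1 d10 d1P] := @move_continuous (fun i => 0) (width T)^-1
  (move_exp (fun i => - center T i) 1 T) e e0.
have [d2 d20 d2P] := @move_continuous (fun i => - center T i) 1 T d1 d10.
(* The dilation factor depends continuously on the set because the width of [T] is nonzero. *)
have : \forall x \near width T, `|(width T)^-1 - x^-1| < d1.
  by have /cvgrPdist_lt/(_ _ d10) := @inv_continuous R (width T) (lt0r_neq0 T0).
move=> /nbhs_ballP[d3 /= d30 d3P].
have [|d4 d40 d4P] := @center_width_continuous T (Num.min d2 d3) cT.
  by rewrite lt_min d20.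
exists (Num.min d2 d4) => [|T' cT' TT']; first by rewrite lt_min d20.
have [|cc ww] := d4P T' cT'.
  by apply: close_exp_le TT'; rewrite ge_min lexx orbT.
apply: d1P => [i||].
- by rewrite subrr (is_norm0 (normN i)).
- by apply: d3P; rewrite /ball/=; apply: lt_le_trans ww _; rewrite ge_min lexx orbT.
apply: d2P => [i||].
- rewrite -opprD (is_normN (normN i)).
  by apply: lt_le_trans (cc i) _; rewrite ge_min lexx.
- by rewrite subrr normr0.
- by apply: close_exp_le TT'; rewrite ge_min lexx.
Qed.

(** * The stratum, the link and the cone map *)

Context (p : omega_star) (cardI : #|I| = p :> nat).

Local Notation fib := (fiber (@exp_card X : metric_exp X -> omega_star) p).

Definition fiber_chart : set fib := [set u | charted (set_val u)].

Lemma nbhs_fiber_chart (u : fiber_chart) (B : set fiber_chart) :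
  nbhs u B <-> exists2 e, 0 < e & forall u' : fiber_chart,
    close_exp e (set_val (set_val u)) (set_val (set_val u')) -> B u'.
Proof.
have cu (v : fiber_chart) : charted (set_val (set_val v)) by exact: set_valP v.
rewrite nbhs_set_type; split=> [[C /nbhs_set_type[D uD DC] CB]|[e e0 eB]].
  have /(nbhs_chartedP _ (cu u))[e e0 eD] := uD.
  by exists e => // u' uu'; apply: CB; apply: DC; exact: eD.
exists [set w | forall u', set_val u' = w -> B u']; last by move=> x; exact.
apply/nbhs_set_type.
exists [set T | forall w, set_val w = T -> forall u', set_val u' = w -> B u'].
  apply/(nbhs_chartedP _ (cu u)); exists e => // T' _ TT' w wE u' u'E.
  by apply: eB; rewrite u'E wE.
by move=> w; exact.
Qed.

Lemma fiber_chart_trace (u : fiber_chart) i :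
  trace (set_val (set_val u)) i = [set center (set_val (set_val u)) i].
Proof.
apply: trace_singleton; first exact: set_valP u.
by rewrite cardI; exact: (set_valP (set_val u)).
Qed.

Lemma link_above (T : link) : (p < exp_card (set_val T))%O.
Proof.
have [cT T0 T1] := set_valP T.
(* With no chart the width would be 0, so the link is empty and the cone is reduced to its tip.
   Positivity is also what makes larger cardinals comparable to [p]. *)
have I0 : (0 < #|I|)%N.
  rewrite lt0n; apply/eqP => /card0_eq I0.
  have : width (set_val T) <= 0.
    by apply: width_le => // i; have := I0 i; rewrite inE.
  by rewrite T1 ler10.
rewrite lt_neqAle; apply/andP; split.
  apply/eqP => pT; have /(width0_card cT) : #|` (set_val T : {fset X})| = #|I|.
    by rewrite cardI pT.
  by rewrite T1 => /eqP; rewrite oner_eq0.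
by rewrite /Order.le/= /omega_star_le -cardI I0 card_charted// orbT.
Qed.

Definition link_strat (T : link) : above p :=
  exist (fun q : omega_star => (p < q)%O) (exp_card (set_val T)) (link_above T).

Definition cone_map (x : fiber_chart * open_cone R link) : metric_exp X :=
  if x.2 is Some (t, T)
  then move_exp (center (set_val (set_val x.1))) (set_val t) (set_val T)
  else set_val (set_val x.1).

Lemma pos_coneP (t : (`]0, +oo[%classic : set R)) : 0 < set_val t.
Proof. by have := set_valP t; rewrite /= in_itv/= andbT. Qed.

Lemma charted_cone_map x : charted (cone_map x).
Proof.
case: x => u [[t T]|]; last exact: (set_valP u).
by apply: charted_move; exact/link_charted/(set_valP T).
Qed.

Lemma center_cone_map u c i :
  center (cone_map (u, c)) i = center (set_val (set_val u)) i.
Proof.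
case: c => [[t T]|//]; have [cT T0 _] := set_valP T.
by rewrite /cone_map/= center_move ?pos_coneP// T0 scaler0 addr0.
Qed.

Lemma width_cone_map_some u t T : width (cone_map (u, Some (t, T))) = set_val t.
Proof.
have [cT _ T1] := set_valP T.
by rewrite /cone_map/= width_move ?pos_coneP// T1 mulr1.
Qed.

Lemma width_cone_map_none u : width (cone_map (u, None)) = 0.
Proof.
apply/(width0_card (charted_cone_map _)); rewrite cardI.
exact: (set_valP (set_val u)).
Qed.

(** All coordinates can be read off the image: the centers give [u], the width gives the height (0
    at the tip), and [normalize] gives the point of the link. *)
Lemma cone_map_inj : injective cone_map.
Proof.
move=> [u c] [u' c'] E.
have uu' : u = u'.
  apply/val_inj/val_inj; apply: charted_inj; [exact: (set_valP u)|exact: (set_valP u')|].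
  move=> i; rewrite -!set_valE !fiber_chart_trace.
  by rewrite -(center_cone_map u c) E center_cone_map.
subst u'; congr (_, _).
have W : width (cone_map (u, c)) = width (cone_map (u, c')) by rewrite E.
case: c c' E W => [[t T]|] [[t' T']|] E //; rewrite ?width_cone_map_some ?width_cone_map_none.
- move=> tt'; have {}tt' : t = t' by exact: val_inj.
  subst t'; congr (Some (_, _)); apply: val_inj.
  pose v := center (set_val (set_val u)).
  apply: etrans (esym (normalize_move v (set_valP T) (pos_coneP t))) _.
  apply: etrans _ (normalize_move v (set_valP T') (pos_coneP t)).
  by congr normalize.
- by move=> t0; have := pos_coneP t; rewrite t0 ltxx.
- by move=> t0; have := pos_coneP t'; rewrite -t0 ltxx.
Qed.

Lemma nbhs_pos_cone (t : (`]0, +oo[%classic : set R)) B :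
  nbhs t B <-> exists2 e : R, 0 < e &
    forall t', `|set_val t - set_val t'| < e -> B t'.
Proof.
rewrite nbhs_set_type; split=> [[C /nbhs_ballP[e /= e0 eC] CB]|[e e0 eB]].
  by exists e => // t' tt'; apply: CB; exact: eC.
exists (ball (set_val t) e); last by move=> t' tt'; exact: eB.
exact: nbhsx_ballx.
Qed.

Lemma nbhs_centers (u : fiber_chart) e : 0 < e ->
  nbhs u [set u' | forall i, N i (center (set_val (set_val u)) i -
                              center (set_val (set_val u')) i) < e].
Proof.
move=> e0; apply/nbhs_fiber_chart.
have [d d0 dP] := center_width_continuous (set_valP u : charted _) e0.
by exists d => // u' uu'; have [] := dP _ (set_valP u' : charted _) uu'.
Qed.

Lemma cone_map_continuous : continuous cone_map.
Proof.
move=> [u c] A /(nbhs_chartedP _ (charted_cone_map _))[e e0 eA].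
case: c eA => [[t T]|] eA.
  have [d d0 dP] := @move_continuous (center (set_val (set_val u))) (set_val t)
    (set_val T) e e0.
  exists ([set u' | forall i, N i (center (set_val (set_val u)) i -
                                center (set_val (set_val u')) i) < d],
    Some @` ([set t' | `|set_val t - set_val t'| < d] `*`
             [set T' | close_exp d (set_val T) (set_val T')])) => /=.
    split; first exact: nbhs_centers.
    apply/nbhs_cone_some.
    exists ([set t' | `|set_val t - set_val t'| < d],
            [set T' | close_exp d (set_val T) (set_val T')]) => /=.
      split; first by apply/nbhs_pos_cone; exists d.
      by apply/(nbhs_charted_subset _ _ link_charted); exists d.
    by move=> z zP; exists z.
  move=> [u' _] [/= uu' [[t' T'] [/= tt' TT'] <-]].
  by apply: eA; [exact: charted_cone_map|exact: dP].
(* At the tip, pieces of link elements have norm at most 1, so a set at height [t] stays within [t]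
   of its centers whatever its link coordinate. Half of [e] is spent on the height, half on moving
   the centers. *)
have e20 : 0 < e / 2 by rewrite divr_gt0.
exists ([set u' | forall i, N i (center (set_val (set_val u)) i -
                              center (set_val (set_val u')) i) < e / 2],
  [set c | if c is Some (t, _) then set_val t < e / 2 else True]) => /=.
  split; first exact: nbhs_centers.
  by apply/nbhs_cone_tip; split => //; exists (e / 2).
move=> [u' c] [/= uu' ce]; apply: eA; first exact: charted_cone_map.
suff key i y : trace (cone_map (u', c)) i y ->
    N i (center (set_val (set_val u)) i - y) < e.
  move=> i; rewrite /cone_map/= fiber_chart_trace; split=> [_ ->|y y'].
    have [y yT] := trace_nonempty i (charted_cone_map (u', c)).
    by exists y => //; exact: key.
  by exists (center (set_val (set_val u)) i) => //; exact: key.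
case: c ce => [[t T]|_]; last first.
  by rewrite /cone_map/= fiber_chart_trace => ->; have := uu' i; lra.
rewrite /cone_map/= trace_move => te [z Tz <-].
have := is_norm_triangle (normN i)
  (center (set_val (set_val u)) i - center (set_val (set_val u')) i)
  (- (set_val t *: z)).
rewrite -addrA -opprD (is_normN (normN i)) (is_norm_posZ (normN i) _ (ltW (pos_coneP t))).
have := uu' i; have := link_norm_le (set_valP T) Tz.
have := is_norm_ge0 (normN i) z; have := pos_coneP t => t0 z0 z1.
have : set_val t * N i z <= set_val t by rewrite ler_piMr// ltW.
lra.
Qed.


(** The set formed by the centers of [T] lies in the stratum; it is the base coordinate of a
    preimage of [T]. *)
Lemma fiber_chart_center T : charted T -> exists u : fiber_chart,
  forall i, center (set_val (set_val u)) i = center T i.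
Proof.
move=> cT; pose S := glue (fun i => [set center T i]).
have S1 i : finite_set [set center T i] by exact: finite_set1.
have cS : charted S by apply: charted_glue => // i; exists (center T i).
have fS : fib S by rewrite /fiber/= /exp_card card_glue1.
pose s : fib := SigSub (mem_set fS).
exists (SigSub (mem_set (cS : fiber_chart s))) => i.
by rewrite /center trace_glue// (cheb1 (normN i) (indN i)).
Qed.

Lemma cone_map_none T (u : fiber_chart) : charted T ->
  (forall i, center (set_val (set_val u)) i = center T i) -> width T = 0 ->
  cone_map (u, None) = T.
Proof.
move=> cT uT T0; apply: charted_inj => //; first exact: charted_cone_map.
by move=> i; rewrite /cone_map/= fiber_chart_trace uT -width_eq0.
Qed.

Lemma cone_map_some T (u : fiber_chart) : charted T ->
  (forall i, center (set_val (set_val u)) i = center T i) -> 0 < width T ->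
  exists (t : (`]0, +oo[%classic : set R)) (T' : link),
    [/\ set_val t = width T, set_val T' = normalize T &
        cone_map (u, Some (t, T')) = T].
Proof.
move=> cT uT T0; have t0 : (`]0, +oo[%classic : set R) (width T).
  by rewrite /= in_itv/= T0.
exists (SigSub (mem_set t0)), (SigSub (mem_set (link_normalize cT T0))); split => //.
rewrite -[RHS]move_normalize// /cone_map/=; congr move_exp.
exact: functional_extensionality_dep.
Qed.

Lemma close_fiber_chart e (u u' : fiber_chart) :
  (forall i, N i (center (set_val (set_val u)) i -
                  center (set_val (set_val u')) i) < e) ->
  close_exp e (set_val (set_val u)) (set_val (set_val u')).
Proof.
move=> uu' i; rewrite !fiber_chart_trace; split=> _ ->.
  by exists (center (set_val (set_val u')) i).
by exists (center (set_val (set_val u)) i).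
Qed.

(** Every charted set has an explicit preimage made of its centers, its width and its normalization.
    These vary continuously, so preimages of sets near the given image lie in [A]. *)
Lemma cone_map_open (A : set (fiber_chart * open_cone R link)) :
  open A -> open (cone_map @` A).
Proof.
move=> oA; rewrite openE => _ [[u c] Auc <-].
have [[B C] /= [uB cC] BC] : nbhs (u, c) A by exact: open_nbhs_nbhs.
have [e1 e10 e1B] := (nbhs_fiber_chart _ _).1 uB.
have cT0 := charted_cone_map (u, c).
apply/(nbhs_chartedP _ cT0).
have centers d : 0 < d -> d <= e1 -> forall T, charted T ->
    (forall i, N i (center (cone_map (u, c)) i - center T i) < d) ->
    exists u' : fiber_chart, B u' /\
      forall i, center (set_val (set_val u')) i = center T i.
  move=> d0 de T cT cc; have [u' u'T] := fiber_chart_center cT.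
  exists u'; split => //; apply: e1B; apply: close_fiber_chart => i.
  by rewrite u'T -(center_cone_map u c); exact: lt_le_trans (cc i) de.
case: c => [[t T]|] in Auc cC cT0 centers *.
  have [[D E] /= [tD TE] DE] := (nbhs_cone_some _ _).1 cC.
  have [e2 e20 e2D] := (nbhs_pos_cone _ _).1 tD.
  have [e3 e30 e3E] := (nbhs_charted_subset _ _ link_charted).1 TE.
  have t0 := pos_coneP t.
  have W0 := width_cone_map_some u t T.
  (* The bound by the height [t] keeps the width of nearby sets positive, so that they can be
     normalized. *)
  pose e := Num.min e1 (Num.min e2 (set_val t)).
  have e0 : 0 < e by rewrite !lt_min e10 e20 t0.
  have [ee1 ee2 eet] : [/\ e <= e1, e <= e2 & e <= set_val t].
    by rewrite /e !ge_min !lexx ?orbT.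
  have [d1 d10 d1P] := center_width_continuous cT0 e0.
  have [|d2 d20 d2P] := normalize_continuous cT0 _ e30; first by rewrite W0.
  exists (Num.min d1 d2) => [|S cS TS]; first by rewrite lt_min d10.
  have [|cc ww] := d1P S cS.
    by apply: close_exp_le TS; rewrite ge_min lexx.
  have nn : close_exp e3 (normalize (cone_map (u, Some (t, T)))) (normalize S).
    by apply: d2P => //; apply: close_exp_le TS; rewrite ge_min lexx orbT.
  have [u' [Bu' u'S]] := centers e e0 ee1 S cS cc.
  rewrite W0 in ww.
  have S0 : 0 < width S by move: ww; rewrite ltr_norml; lra.
  have [t' [T' [t'E T'E <-]]] := cone_map_some cS u'S S0.
  exists (u', Some (t', T')) => //; apply: BC; split => //=.
  apply: (DE (t', T')); split => /=.
    by apply: e2D; rewrite t'E; exact: lt_le_trans ww ee2.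
  apply: e3E; rewrite T'E; move: nn.
  by rewrite /cone_map/= normalize_move//; exact: (set_valP T).
have [C0 [e2 e20 e2C]] := (nbhs_cone_tip _).1 cC.
pose e := Num.min e1 e2.
have e0 : 0 < e by rewrite lt_min e10 e20.
have [ee1 ee2] : e <= e1 /\ e <= e2 by rewrite /e !ge_min !lexx ?orbT.
have [d1 d10 d1P] := center_width_continuous cT0 e0.
exists d1 => // S cS TS; have [cc ww] := d1P S cS TS.
have [u' [Bu' u'S]] := centers e e0 ee1 S cS cc.
rewrite width_cone_map_none sub0r normrN ger0_norm ?width_ge0// in ww.
(* Near the tip a set has either width 0, with preimage at the tip, or small positive width, where
   any link coordinate is allowed. *)
have [S0|S0] := leP (width S) 0.
  exists (u', None); first by apply: BC.
  by apply: cone_map_none => //; apply/eqP; rewrite eq_le S0 width_ge0.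
have [t' [T' [t'E T'E <-]]] := cone_map_some cS u'S S0.
exists (u', Some (t', T')) => //; apply: BC; split => //=.
by apply: e2C; rewrite t'E; exact: lt_le_trans ww ee2.
Qed.

Lemma open_embedding_cone_map : open_embedding cone_map.
Proof.
split; [exact: cone_map_continuous|exact: cone_map_inj|exact: cone_map_open].
Qed.

Lemma open_fiber_chart : open fiber_chart.
Proof. by exists charted => //; exact: open_charted. Qed.

Lemma exp_card_cone_map u c :
  exp_card (cone_map (u, c)) = above_cone_val (cone_strat link_strat c).
Proof.
case: c => [[t T]|]; last exact: (set_valP (set_val u)).
apply: card_move; first by rewrite gt_eqF// pos_coneP.
by apply: link_charted; exact: (set_valP T).
Qed.

Lemma link_strat_stratified :
  stratified (@exp_card X : metric_exp X -> omega_star) -> stratified link_strat.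
Proof.
move=> sX; apply/continuousP => A uA; rewrite openE => T AT.
apply/nbhs_set_type.
exists [set T' : metric_exp X | (exp_card (set_val T) <= exp_card T')%O].
  apply: (sX (set_val T) [set n | (exp_card (set_val T) <= n)%O]).
  apply: open_nbhs_nbhs; split; last exact: lexx.
  by move=> m n /= Tm mn; exact: le_trans Tm mn.
by move=> T' TT'; apply: uA AT _.
Qed.

Lemma conical_chart (y : fib) : charted (set_val y) ->
  stratified (@exp_card X : metric_exp X -> omega_star) ->
  exists (U : set fib) (L : topologicalType) (l : L -> above p)
         (h : U * open_cone R L -> metric_exp X),
    [/\ open_nbhs y U, stratified l, open_embedding h,
        forall u : U, h (u, cone_tip R L) = \val (\val u) &
        forall (u : U) (c : open_cone R L),
          exp_card (h (u, c)) = above_cone_val (cone_strat l c)].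
Proof.
move=> cy sX; exists fiber_chart, link, link_strat, cone_map; split => //.
- by split; [exact: open_fiber_chart|exact: cy].
- exact: link_strat_stratified.
- exact: open_embedding_cone_map.
- exact: exp_card_cone_map.
Qed.

End Charts.

(** * Disjoint charts around a finite set, and the conclusion *)

Lemma hausdorff_separate_fset (X : topologicalType) (S : {fset X}) :
  hausdorff_space X -> exists W : X -> set X,
    (forall x, x \in S -> open (W x) /\ W x x) /\
    forall x y, x \in S -> y \in S -> W x `&` W y !=set0 -> x = y.
Proof.
rewrite open_hausdorff => hX.
have /choice[G GP] : forall z : X * X, exists AB : set X * set X, z.1 != z.2 ->
    [/\ open AB.1, open AB.2, AB.1 z.1, AB.2 z.2 & AB.1 `&` AB.2 = set0].
  move=> [x y] /=; have [->|xy] := eqVneq x y; first by exists (set0, set0).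
  have [AB [/set_mem Ax /set_mem By] [oA oB /eqP AB0]] := hX _ _ xy.
  by exists AB.
(* The separating pairs are chosen for ordered pairs with no symmetry, so [W x] takes the first
   member for [(x, y)] and the second for [(y, x)]. *)
pose W x := \bigcap_(y in [set` S])
  [set w | x != y -> (G (x, y)).1 w /\ (G (y, x)).2 w].
exists (fun x => (W x)^°); split=> [x xS|x y xS yS [w [Wx Wy]]].
  split; first exact: open_interior.
  apply: filter_bigI => y yS; have [<-|xy] := eqVneq x y.
    by apply: filterE.
  have [oA _ Ax _ _] := GP (x, y) xy.
  have [|_ oB _ Bx _] := GP (y, x); first by rewrite eq_sym.
  have : nbhs x ((G (x, y)).1 `&` (G (y, x)).2).
    by apply: filterI; apply: open_nbhs_nbhs.
  by apply: filterS => w [Aw Bw] _; split.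
apply/eqP; apply: contrapT => /negP xy.
have [_ _ _ _ AB0] := GP (x, y) xy.
have [Aw _] := nbhs_singleton Wx _ yS xy.
have [|_ Bw] := nbhs_singleton Wy _ xS; first by rewrite eq_sym.
by have : ((G (x, y)).1 `&` (G (x, y)).2) w by []; rewrite AB0.
Qed.

(** The charts are indexed by the points of [S] and shrunk into pairwise disjoint neighbourhoods,
    each sending 0 to its point. *)
Lemma exists_charts (R : realType) (X : topologicalType) (S : metric_exp X) :
  hausdorff_space X -> locally_rotund R X ->
  exists (I : finType) (V : I -> topologicalLmodType R) (psi : forall i, V i -> X),
    [/\ #|I| = #|` (S : {fset X})|, forall i, rotund (V i),
        forall i, open_embedding (psi i),
        forall i j x y, psi i x = psi j y -> i = j & charted psi S].
Proof.
move=> hX rX; pose I : finType := fset_sub_type (S : {fset X}).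
have [W [oW Wdisj]] := hausdorff_separate_fset S hX.
have /choice[Vpsi VP] : forall i : I,
    exists Vpsi : {V : topologicalLmodType R & V -> X},
      [/\ rotund (projT1 Vpsi), open_embedding (projT2 Vpsi),
          projT2 Vpsi 0 = \val i & range (projT2 Vpsi) `<=` W (\val i)].
  move=> i; have [oWi Wi] := oW _ (valP i).
  by have [V [psi VP]] := rotund_chart rX oWi Wi; exists (existT _ V psi).
exists I, (fun i => projT1 (Vpsi i)), (fun i => projT2 (Vpsi i)); split.
- by rewrite cardfE.
- by move=> i; case: (VP i).
- by move=> i; case: (VP i).
- move=> i j x y E; apply/val_inj/Wdisj; [exact: valP|exact: valP|].
  exists (projT2 (Vpsi i) x); split; first by case: (VP i) => _ _ _; apply; exists x.
  by rewrite E; case: (VP j) => _ _ _; apply; exists y.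
- split=> [x xS|i].
    by exists (Sub x xS : I), 0; case: (VP (Sub x xS)) => _ _ ->.
  by exists 0; rewrite /trace/=; case: (VP i) => _ _ -> _; exact: valP.
Qed.

Theorem theorem4p12 (R : realType) (X : topologicalType)
    (X_separated : hausdorff_space X) (X_locally_rotund : locally_rotund R X) :
  conically_stratified R (@exp_card X : metric_exp X -> omega_star).
Proof.
have charts S : exists (I : finType) (V : I -> topologicalLmodType R)
    (N : forall i, V i -> R) (psi : forall i, V i -> X),
    [/\ #|I| = #|` (S : {fset X})|,
        forall i, [/\ is_norm (N i), induces_topology (N i) &
          forall x y, N i x = N i y -> N i y = N i (2^-1 *: (x + y)) -> x = y],
        forall i, open_embedding (psi i),
        forall i j x y, psi i x = psi j y -> i = j & charted psi S].
  have [I [V [psi [cardI rV psiE psi_disjoint cS]]]] :=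
    exists_charts S X_separated X_locally_rotund.
  by have /fin_all_exists[N NP] := rV; exists I, V, N, psi.
have sX : stratified (@exp_card X : metric_exp X -> omega_star).
  (* On the neighbourhood of charted sets the cardinality is at least that of [S], which suffices
     for upward-closed [A]. *)
  apply/continuousP => A uA; rewrite openE => S AS.
  have [I [V [N [psi [cardI NP psiE psi_disjoint cS]]]]] := charts S.
  have nS : nbhs S (charted psi).
    by apply: (@nbhs_charted _ _ _ _ N) => // i; case: (NP i).
  apply: filterS nS => T cT; apply: uA AS _.
  exact: (exp_card_le_charted psiE psi_disjoint cS cT).
split => // p y.
have [I [V [N [psi [cardI NP psiE psi_disjoint cy]]]]] := charts (set_val y).
apply: (@conical_chart _ _ _ _ N psi) => //.
- by move=> i; case: (NP i).
- by move=> i; case: (NP i).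
- by move=> i; case: (NP i).
- by rewrite cardI; exact: (set_valP y).
Qed.
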